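(* Let $\mathbb{F}$ be an infinite field. Then for every integer $n\ge 6$ the unitriangular group $UT_n(\mathbb{F})$ has infinitely many automorphism orbits.
   Context: For a group $G$, the automorphism orbits of $G$ are the orbits of the natural action of $\mathrm{Aut}(G)$, the full group of abstract group automorphisms, on the set $G$. For a field $\mathbb{F}$, $UT_n(\mathbb{F})$ is the group (under multiplication) of $n\times n$ upper triangular matrices over $\mathbb{F}$ with all diagonal entries equal to $1$. *)

(* Defs.v *)
From HB Require Import structures.
From mathcomp Require Import all_boot all_algebra.
From mathcomp Require Import all_classical.

Set Implicit Arguments.
Unset Strict Implicit.
Unset Printing Implicit Defensive.

Import GRing.Theory.
Local Open Scope ring_scope.

(* MathComp's [is_trig_mx] means lower triangular, hence the transpose. *)
Definition is_unitrig_mx (F : fieldType) (n : nat) (M : 'M[F]_n) : bool :=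
  is_trig_mx M^T && [forall i, M i i == 1].

Lemma is_unitrig_mxP (F : fieldType) (n : nat) (M : 'M[F]_n) :
  reflect (forall i j : 'I_n, (j <= i)%N -> M i j = (i == j)%:R)
          (is_unitrig_mx M).
Proof.
apply: (iffP andP) => [[/is_trig_mxP MT /forallP M1] i j | MP].
  rewrite leq_eqVlt => /predU1P[/val_inj-> | ltji]; first by rewrite eqxx (eqP (M1 i)).
  by have := MT _ _ ltji; rewrite mxE => ->; rewrite -val_eqE gtn_eqF.
split.
  by apply/is_trig_mxP => i j ltij; rewrite mxE MP 1?ltnW // -val_eqE gtn_eqF.
by apply/forallP => i; rewrite MP // eqxx.
Qed.

Lemma unitrig_mx1 (F : fieldType) (n : nat) :
  is_unitrig_mx (1%:M : 'M[F]_n).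
Proof. by apply/is_unitrig_mxP => i j _; rewrite mxE. Qed.

Lemma unitrig_mxM (F : fieldType) (n : nat) (M N : 'M[F]_n) :
  is_unitrig_mx M -> is_unitrig_mx N -> is_unitrig_mx (M *m N).
Proof.
move=> /is_unitrig_mxP MP /is_unitrig_mxP NP.
apply/is_unitrig_mxP => i j leji.
rewrite mxE (bigD1 i) //= MP // eqxx mul1r NP // big1 ?addr0 // => k nki.
have [ltki|leik] := ltnP k i; first by rewrite MP 1?ltnW // eq_sym (negPf nki) mul0r.
have ltik : (i < k)%N by rewrite ltn_neqAle leik andbT eq_sym; apply: nki.
have ltjk := leq_ltn_trans leji ltik.
by rewrite NP 1?ltnW // -val_eqE gtn_eqF // mulr0.
Qed.

Lemma unitrig_mx_unit (F : fieldType) (n : nat) (M : 'M[F]_n) :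
  is_unitrig_mx M -> M \in unitmx.
Proof.
move=> /andP[MT /forallP M1]; rewrite unitmxE -det_tr det_trig // big1 ?unitr1 //.
by move=> i _; rewrite mxE (eqP (M1 i)).
Qed.

Lemma unitrig_mxV (F : fieldType) (n : nat) (M : 'M[F]_n) :
  is_unitrig_mx M -> is_unitrig_mx (invmx M).
Proof.
move=> UM; have MV := mulmxV (unitrig_mx_unit UM).
move/is_unitrig_mxP: UM => MP; apply/is_unitrig_mxP => i j.
have [m] := ubnP (n - i)%N; elim: m => // m IHm in i j * => ltm leji.
have := congr1 (fun A : 'M_n => A i j) MV.
rewrite !mxE (bigD1 i) //= MP // eqxx mul1r big1 ?addr0 // => k nki.
have [ltki|leik] := ltnP k i; first by rewrite MP 1?ltnW // eq_sym (negPf nki) mul0r.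
have ltik : (i < k)%N by rewrite ltn_neqAle leik andbT eq_sym; apply: nki.
have ltjk := leq_ltn_trans leji ltik.
have ltnk : (n - k < m)%N.
  by rewrite (leq_trans _ (ltm : (n - i <= m)%N)) // ltn_sub2l.
by rewrite (IHm _ _ ltnk (ltnW ltjk)) -val_eqE gtn_eqF // mulr0.
Qed.

Record UT (n : nat) (F : fieldType) : Type :=
  MkUT { UTval :> 'M[F]_n; UTvalP : is_unitrig_mx UTval }.

HB.instance Definition _ n F := [isSub for @UTval n F].
HB.instance Definition _ n F := [Choice of UT n F by <:].

Section UTGroup.
Variables (n : nat) (F : fieldType).
Implicit Types x y : UT n F.

Definition UTone : UT n F := MkUT (unitrig_mx1 F n).
Definition UTmul x y : UT n F := MkUT (unitrig_mxM (UTvalP x) (UTvalP y)).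
Definition UTinv x : UT n F := MkUT (unitrig_mxV (UTvalP x)).

Lemma UTmulA : associative UTmul.
Proof. by move=> x y z; apply/val_inj/mulmxA. Qed.
Lemma UTmul1 : left_id UTone UTmul.
Proof. by move=> x; apply/val_inj/mul1mx. Qed.
Lemma UTmulr1 : right_id UTone UTmul.
Proof. by move=> x; apply/val_inj/mulmx1. Qed.
Lemma UTmulV : left_inverse UTone UTinv UTmul.
Proof. by move=> x; apply/val_inj/mulVmx/unitrig_mx_unit/UTvalP. Qed.
Lemma UTmulrV : right_inverse UTone UTinv UTmul.
Proof. by move=> x; apply/val_inj/mulmxV/unitrig_mx_unit/UTvalP. Qed.

HB.instance Definition _ :=
  isGroup.Build (UT n F) UTmulA UTmul1 UTmulr1 UTmulV UTmulrV.

End UTGroup.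

Definition aut_orbit (G : groupType) (x : G) : set G :=
  [set y | exists f : {multiplicative G -> G}, bijective f /\ f x = y]%classic.

Definition aut_orbits (G : groupType) : set (set G) :=
  range (@aut_orbit G).
Arguments aut_orbits G : clear implicits.

(* Main.v *)
(** (1) An infinite field [F] has infinitely many classes of elements under its endomorphisms.
    In characteristic 0 the naturals are fixed.  In characteristic [p], suppose there are
    finitely many classes and put [P(x) = x^p - x].  Then [P] is not onto (iterated preimages of
    1 would be inequivalent), but the images of its iterates stabilize, so [P(F)] has finite
    index.  By pigeonhole [x^(1+p^i) - x^(1+p^j)] lies in [P(F)] for all [x] and some [i < j].
    Polarizing, and using [z^p = z] modulo [P(F)], gives a nonzero [c] with [x c] in [P(F)] for
    all [x], so [P] is onto after all.

    (2) With rows and columns numbered from 0 and [N = n - 1], let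
    [u_l = (1 + E_{0,1}) (1 + E_{N-1,N}) (1 + X_l)], where [X_l] is supported on rows 1, 2 and
    columns [N-2], [N-1] and has the entries [l, 1; 1, 1] there.  If an automorphism [f] maps
    [u_l] to [u_m] and does not swap the two ends of the superdiagonal, then a field
    endomorphism maps [l] to [m].  Indeed, for some [r] with [2 < r < n - 2], [f]
    preserves the abelian group [A] of matrices supported (off the diagonal) on rows [< r] and
    columns [>= r], and the groups [L], [R] of matrices with trivial rows [>= r], resp. trivial
    columns [< r]: all arise from lower central series by taking centralizers.  Since the
    elements of [L] supported on columns [< r] commute with those of [R] supported on rows
    [>= r], [f] can change the off-diagonal block of [1 + E_{0,1}] and [1 + E_{N-1,N}]
    only in row 0 and column [N], so the rows 1, 2 and columns [N-2], [N-1] of [f (1 + X_l) - 1]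
    are those of [X_m]. Finally the additive map induced by [f] on [A] is compatible with the
    actions of [L] and [R]; on these four entries it is therefore diagonal, and comparing the
    entries through [1 + t E_{1,2}] and [1 + t E_{N-2,N-1}] shows that it acts by one and the
    same ring endomorphism.

    Automorphisms that do not swap the ends have index at most 2 (in the weak sense that two
    swaps compose to a non-swap), hence finitely many orbits would contradict (1). *)

Require Import Defs.
From HB Require Import structures.
From mathcomp Require Import all_boot all_algebra all_classical ring zify.

Set Implicit Arguments.
Unset Strict Implicit.
Unset Printing Implicit Defensive.

Import GRing.Theory.
Local Open Scope ring_scope.

(** * Endomorphism classes of an infinite field *)

Lemma pigeonhole_seq (T : eqType) (t : seq T) (f : nat -> T) :
  (forall i, f i \in t) -> exists i j, (i < j)%N /\ f i = f j.
Proof.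
move=> ft; have [uf|] := boolP (uniq (map f (iota 0 (size t).+1))).
  have /(uniq_leq_size uf): {subset map f (iota 0 (size t).+1) <= t}.
    by move=> _ /mapP[i _ ->].
  by rewrite size_map size_iota ltnn.
case/(uniqPn (f 0)) => i [j [ltij]]; rewrite size_map size_iota => ltj.
rewrite !(nth_map 0) ?size_iota ?(ltn_trans ltij) // !nth_iota ?(ltn_trans ltij) //.
by rewrite !add0n => eqf; exists i, j.
Qed.

Lemma poly_roots_seq (F : fieldType) (q : {poly F}) :
  q != 0 -> exists s : seq F, forall x, root q x -> x \in s.
Proof.
have [m] := ubnP (size q); elim: m q => // m IHm q ltqm q0.
have [[a /factor_theorem[q' Dq]]|nor] := pselect (exists a, root q a).
  have q'0 : q' != 0 by apply: contraNneq q0 => q'0; rewrite Dq q'0 mul0r.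
  have [|s Hs] := IHm q' _ q'0.
    by move: ltqm; rewrite Dq size_Mmonic ?monicXsubC // size_XsubC addn2.
  exists (a :: s) => x; rewrite Dq rootM root_XsubC inE => /orP[/Hs->|->] //.
  by rewrite orbT.
by exists [::] => x rx; case: nor; exists x.
Qed.

Lemma infinite_notin (T : eqType) : infinite_set [set: T] ->
  forall s : seq T, exists x, x \notin s.
Proof.
move=> infT s; apply: contrapT => Hs; apply: infT.
apply: (@sub_finite_set _ _ [set` s]) => [x _|]; last exact: finite_seq.
by apply: contrapT => /negP xs; apply: Hs; exists x.
Qed.

Lemma poly_nonroot (F : fieldType) (q : {poly F}) :
  infinite_set [set: F] -> q != 0 -> exists x, q.[x] != 0.
Proof.
move=> infF /poly_roots_seq[s Hs]; have [x xs] := infinite_notin infF s.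
by exists x; apply: contra xs => /Hs.
Qed.

(** Field endomorphisms need not be invertible, so one is required in each direction; this makes the
    relation symmetric. *)
Definition endo_equiv (F : fieldType) (x y : F) : Prop :=
  (exists sigma : {rmorphism F -> F}, sigma x = y) /\
  (exists tau : {rmorphism F -> F}, tau y = x).

Lemma endo_equiv_trans_l (F : fieldType) (x y z : F) :
  endo_equiv x y -> endo_equiv x z -> endo_equiv y z.
Proof.
move=> [[s1 e1] [t1 d1]] [[s2 e2] [t2 d2]]; split.
  by exists (s2 \o t1) => /=; rewrite d1.
by exists (s1 \o t2) => /=; rewrite d2.
Qed.

Section FewClasses.
Variables (F : fieldType) (s : seq F).
Hypothesis reps : forall x, exists2 y, y \in s & endo_equiv y x.

Lemma endo_equiv_pigeonhole (x : nat -> F) :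
  exists i j, (i < j)%N /\ endo_equiv (x i) (x j).
Proof.
have /choice[r Hr] : forall y, exists z, z \in s /\ endo_equiv z y.
  by move=> y; have [z] := reps y; exists z.
have [i [j [ltij eqr]]] := pigeonhole_seq (f := r \o x) (t := s) (fun i => (Hr _).1).
exists i, j; split=> //; apply: endo_equiv_trans_l (Hr (x i)).2 _.
by have:= (Hr (x j)).2; rewrite /= in eqr; rewrite eqr.
Qed.

Lemma few_classes_pchar : exists p, p \in [pchar F].
Proof.
apply: contrapT => noc.
have /pcharf0P F0 : [pchar F] =i pred0 by move=> p; apply/negP => cp; apply: noc; exists p.
have [i [j [ltij [[sg Hsg] _]]]] := endo_equiv_pigeonhole (fun k => k%:R).
move/eqP: Hsg; rewrite rmorph_nat eq_sym -subr_eq0 -natrB ?(ltnW ltij) // F0 subn_eq0.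
by rewrite leqNgt ltij.
Qed.

(** * Positive characteristic: the Artin-Schreier map [P] and its image [I] *)

Section AS.
Variable p : nat.
Hypothesis cp : p \in [pchar F].
Let P (x : F) := x ^+ p - x.
Let I (z : F) := exists y, P y = z.

Let p_gt1 : (1 < p)%N. Proof. exact/prime_gt1/(pcharf_prime cp). Qed.
Let pnat_exp i : p.-nat (p ^ i)%N.
Proof. by rewrite pnatX pnat_id ?(pcharf_prime cp) ?orTb. Qed.

Let frobD i : {morph (fun x : F => x ^+ (p ^ i)) : x y / x + y}.
Proof. by move=> x y; rewrite (@exprDn_pchar F) // (eq_pnat _ (pcharf_eq cp)). Qed.
Let frobB i : {morph (fun x : F => x ^+ (p ^ i)) : x y / x - y}.
Proof.
move=> x y; apply/(canRL (addrK _)).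
by rewrite -(frobD i) /= addrNK.
Qed.

Let PB : {morph P : x y / x - y}.
Proof.
move=> x y; have := frobB 1 x y; rewrite /= expn1 /P => ->.
ring.
Qed.
Let P0 : P 0 = 0. Proof. by have := PB 0 0; rewrite !subrr. Qed.
Let iterPB k : {morph iter k P : x y / x - y}.
Proof. by elim: k => // k IHk x y; rewrite /= IHk PB. Qed.
Let iterP0 k : iter k P 0 = 0.
Proof. by elim: k => // k IHk; rewrite /= IHk P0. Qed.
Let rmorphP (sg : {rmorphism F -> F}) k x : sg (iter k P x) = iter k P (sg x).
Proof. by elim: k => // k IHk; rewrite /= {1}/P rmorphB rmorphXn /= IHk. Qed.

Let IB x y : I x -> I y -> I (x - y).
Proof. by move=> [a <-] [b <-]; exists (a - b); rewrite PB. Qed.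
Let ID x y : I x -> I y -> I (x + y).
Proof. by move=> Ix Iy; rewrite -[y]opprK -[- y]sub0r; do !apply: IB => //; exists 0. Qed.
Let IX i z : I (z ^+ (p ^ i) - z).
Proof.
elim: i => [|i IHi]; first by rewrite subrr; exists 0.
rewrite -(subrK (z ^+ (p ^ i)) (_ ^+ _)) -addrA; apply: ID => //.
by exists (z ^+ (p ^ i)); rewrite /P -exprM -expnSr.
Qed.

(** For a section [g] of [P], [iter k P] sends [iter k g 1] to 1 and one further step gives 0.
    Endomorphisms commute with [P], so they preserve this vanishing and cannot raise the level
    [k]. *)
Let nsurj : exists z, ~ I z.
Proof.
apply: contrapT => nI; have surj z : I z by apply: contrapT => nIz; apply: nI; exists z.
have [g gK] := choice surj.
have iterK k x : iter k P (iter k g x) = x.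
  by elim: k x => // k IHk x; rewrite iterSr /= gK.
have [i [j [ltij [[sg Hsg] _]]]] := endo_equiv_pigeonhole (fun k => iter k g 1).
have P1 : P 1 = 0 by rewrite /P expr1n subrr.
have := congr1 P (iterK i 1); rewrite -iterS P1 => /(congr1 sg).
rewrite rmorphP Hsg rmorph0 -(subnKC ltij) iterD iterK.
move/(congr1 (iter (j - i.+1) P)); rewrite iterP0 iterK => /eqP.
by rewrite oner_eq0.
Qed.

(** Otherwise, elements of the image of [iter k P] outside that of [iter k.+1 P] would be pairwise
    inequivalent for different [k], as endomorphisms map each image into itself. *)
Let stable : exists k, forall x, exists y, iter k P x = iter k.+1 P y.
Proof.
apply: contrapT => nst.
have /choice[x Hx] : forall k, exists x, forall y, iter k P x <> iter k.+1 P y.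
  move=> k; apply: contrapT => Hk; apply: nst; exists k => x.
  apply: contrapT => Hx; apply: Hk; exists x => y e; apply: Hx; by exists y.
have [i [j [ltij [_ [tau Htau]]]]] := endo_equiv_pigeonhole (fun k => iter k P (x k)).
apply: (Hx i (tau (iter (j - i.+1) P (x j)))).
by rewrite -rmorphP -iterD subnKC.
Qed.

Let ker_seq k : exists t : seq F, forall x, iter k P x = 0 -> x \in t.
Proof.
elim: k => [|k [t Ht]]; first by exists [:: 0] => x /= ->; rewrite inE.
have /choice[r Hr] : forall a : F, exists r : seq F, forall x, P x = a -> x \in r.
  move=> a; have [|r Hr] := @poly_roots_seq F ('X^p - 'X - a%:P).
    rewrite -size_poly_gt0 -addrA size_polyDl size_polyXn //.
    by rewrite -opprD size_polyN size_XaddC.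
  by exists r => x Px; apply: Hr; rewrite rootE !hornerE -/(P x) Px subrr.
exists (flatten (map r t)) => x; rewrite iterSr => /Ht Pxt.
by apply/flatten_mapP; exists (P x) => //; apply: Hr.
Qed.

(** If [iter k P x = iter k.+1 P y], then [x - P y] lies in the kernel of [iter k P]; this finite
    kernel thus meets every coset of the image of [P]. *)
Let finite_index : exists (t : seq F) (c : F -> F),
  forall x, c x \in t /\ I (x - c x).
Proof.
have [k Hk] := stable; have [t Ht] := ker_seq k.
have /choice[c Hc] : forall x, exists c, c \in t /\ I (x - c).
  move=> x; have [y Dy] := Hk x; exists (x - P y); split.
    by apply: Ht; rewrite iterPB Dy -iterSr subrr.
  by rewrite opprB addrC subrK; exists y.
by exists t, c.
Qed.

Let power_pair : exists i j, (i < j)%N /\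
  forall x, I (x ^+ (p ^ i).+1 - x ^+ (p ^ j).+1).
Proof.
have [t [c Hc]] := finite_index.
(* The code of [i] records, for each representative in [s], the coset of its power of exponent 1 +
   p^i. Endomorphisms commute with [P], so agreement on [s] carries over to all of [F]. *)
pose code i : {ffun 'I_(size s) -> 'I_(size t).+1} :=
  [ffun l => inord (index (c (tnth (in_tuple s) l ^+ (p ^ i).+1)) t)].
have [i [j [ltij /ffunP eqc]]] :=
  pigeonhole_seq (t := enum {: {ffun 'I_(size s) -> 'I_(size t).+1}})
                 (f := code) (fun i => mem_enum _ _).
exists i, j; split=> // x; have [y ys [[sg <-] _]] := reps x.
suff [z Dz] : I (y ^+ (p ^ i).+1 - y ^+ (p ^ j).+1).
  by exists (sg z); rewrite -[P _](rmorphP sg 1) /= Dz rmorphB !rmorphXn.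
have [l ->] : exists l, y = tnth (in_tuple s) l.
  by apply/tnthP; rewrite memtE.
have := congr1 val (eqc l); rewrite !ffunE /=; set a := _ ^+ _; set b := _ ^+ _.
rewrite !inordK ?ltnS ?index_size // => /(congr1 (nth 0 t)).
rewrite !nth_index ?(Hc _).1 // => eqab.
have := IB (Hc a).2 (Hc b).2; rewrite eqab opprB addrA addrNK; apply.
Qed.

Lemma few_classes_false : infinite_set [set: F] -> False.
Proof.
move=> infF; have [i [j [ltij Iij]]] := power_pair; have [z0 nIz0] := nsurj.
(* Put w = y^(p^j) for the second variable of the polarized form [IB2], raise terms to powers of [p]
   (harmless modulo [I]) until each contains x^(p^j), and take a p^j-th root: the result is [x *
   L.[y]]. The linear coefficient of [L] is -1 since 0 <= i < j. *)
pose L : {poly F} := 'X^(p ^ (i + j)) + 'X^(p ^ (j - i)) - 'X^(p ^ (j + j)) - 'X.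
have L0 : L != 0.
  have e1 m : (0 < m)%N -> (1 == p ^ m)%N = false.
    by move=> m0; rewrite eq_sym -(expn0 p) eqn_exp2l // gtn_eqF.
  apply/eqP => /(congr1 (fun q : {poly F} => q`_1)) /eqP.
  have j0 := leq_ltn_trans (leq0n i) ltij.
  rewrite !coefE !e1 ?subn_gt0 ?addn_gt0 ?j0 ?orbT //.
  by rewrite /= addr0 subr0 sub0r oppr_eq0 oner_eq0.
have [y Ly] := poly_nonroot infF L0.
apply: nIz0; suff IL x : I (x * L.[y]) by rewrite -(divfK Ly z0).
have IB2 x1 y1 : I (x1 * y1 ^+ (p ^ i) + x1 ^+ (p ^ i) * y1
                    - x1 * y1 ^+ (p ^ j) - x1 ^+ (p ^ j) * y1).
  have := IB (IB (Iij (x1 + y1)) (Iij x1)) (Iij y1).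
  rewrite !exprS (frobD i x1 y1) (frobD j x1 y1) /=; congr I; ring.
suff Ib : I ((x * L.[y]) ^+ (p ^ j)).
  by rewrite -[x * _](subKr ((x * L.[y]) ^+ (p ^ j))); apply: IB => //; apply: IX.
set w := y ^+ (p ^ j).
have -> : (x * L.[y]) ^+ (p ^ j) =
    (x * w ^+ (p ^ i)) ^+ (p ^ j) + (x ^+ (p ^ i) * w) ^+ (p ^ (j - i))
    - (x * w ^+ (p ^ j)) ^+ (p ^ j) - x ^+ (p ^ j) * w.
  have wX k : (y ^+ (p ^ k)) ^+ (p ^ j) = w ^+ (p ^ k) by rewrite exprAC.
  rewrite exprMn !hornerE (frobB j) /= (frobB j) /= (frobD j) /= !wX -/w.
  rewrite !exprMn -!exprM -!expnD subnKC ?(ltnW ltij) //; ring.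
have := ID (ID (IX j (x * w ^+ (p ^ i))) (IX (j - i) (x ^+ (p ^ i) * w)))
  (IB (IB2 x w) (IX j (x * w ^+ (p ^ j)))).
by congr I; ring.
Qed.
End AS.
End FewClasses.

Lemma endo_classes_infinite (F : fieldType) : infinite_set [set: F] ->
  forall s : seq F, exists x, forall y, y \in s -> ~ endo_equiv y x.
Proof.
move=> infF s; apply: contrapT => Hs.
have reps x : exists2 y, y \in s & endo_equiv y x.
  apply: contrapT => Hx; apply: Hs; exists x => y ys yx; apply: Hx.
  by exists y.
have [p cp] := few_classes_pchar reps.
exact: few_classes_false reps _ cp infF.
Qed.

(** * Matrices of prescribed support *)

Section Support.
Variables (F : fieldType) (N : nat).
Local Notation M := 'M[F]_N.+1.

(** Patterns live on natural numbers, so that the support of a product becomes a question of linear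
    arithmetic. *)
Definition supp (T : nat -> nat -> bool) (A : M) :=
  forall i j, A i j != 0 -> T i j.

Lemma supp0 T A (i j : 'I_N.+1) : supp T A -> ~~ T i j -> A i j = 0.
Proof. by move=> TA /negP nT; apply: contrapT => /eqP /TA. Qed.

Lemma suppW (T T' : nat -> nat -> bool) A : supp T A -> (forall i j, T i j -> T' i j) -> supp T' A.
Proof. by move=> TA TT' i j /TA /TT'. Qed.

Lemma supp_zero T : supp T 0.
Proof. by move=> i j; rewrite mxE eqxx. Qed.

Lemma suppD T A B : supp T A -> supp T B -> supp T (A + B).
Proof.
move=> TA TB i j; rewrite mxE; apply: contra_neqT => nT.
by rewrite (supp0 TA nT) (supp0 TB nT) addr0.
Qed.

Lemma suppN T A : supp T A -> supp T (- A).
Proof. by move=> TA i j; rewrite mxE oppr_eq0; apply: TA. Qed.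

Lemma suppB T A B : supp T A -> supp T B -> supp T (A - B).
Proof. by move=> TA TB; apply/suppD/suppN. Qed.

Lemma suppM (T1 T2 T : nat -> nat -> bool) A B : supp T1 A -> supp T2 B ->
  (forall i k j, (i <= N)%N -> (k <= N)%N -> (j <= N)%N ->
    T1 i k -> T2 k j -> T i j) -> supp T (A *m B).
Proof.
move=> TA TB TT i j; apply: contra_neqT => nT; rewrite mxE big1 // => k _.
have [/TA Tik|/negbNE/eqP->] := boolP (A i k != 0); last by rewrite mul0r.
have [/TB Tkj|/negbNE/eqP->] := boolP (B k j != 0); last by rewrite mulr0.
by rewrite (TT i k j) // -ltnS in nT.
Qed.

Lemma suppM0 (T1 T2 : nat -> nat -> bool) A B : supp T1 A -> supp T2 B ->
  (forall i k j, (i <= N)%N -> (k <= N)%N -> (j <= N)%N ->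
    T1 i k -> T2 k j -> False) -> A *m B = 0.
Proof.
move=> TA TB TT; have S : supp (fun _ _ => false) (A *m B).
  by apply: (suppM TA TB) => i k j iN kN jN Tik /(TT _ _ _ iN kN jN Tik).
by apply/matrixP => i j; rewrite [RHS]mxE (supp0 S).
Qed.

Lemma supp_delta (i j : 'I_N.+1) c (T : nat -> nat -> bool) :
  T i j -> supp T (c *: delta_mx i j : M).
Proof.
move=> Tij k l; rewrite !mxE; have [->|] := eqVneq k i; last by rewrite mulr0 eqxx.
by have [->|] := eqVneq l j; last by rewrite mulr0 eqxx.
Qed.

Lemma mulmx_deltar (A : M) (i j k l : 'I_N.+1) :
  (A *m delta_mx i j) k l = if l == j then A k i else 0.
Proof.
rewrite mxE (bigD1 i) //= big1 => [|m mi]; last by rewrite mxE (negPf mi) mulr0.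
by rewrite mxE eqxx addr0; case: eqP => _; rewrite ?mulr1 ?mulr0.
Qed.

Lemma mulmx_deltal (A : M) (i j k l : 'I_N.+1) :
  (delta_mx i j *m A) k l = if k == i then A j l else 0.
Proof.
rewrite mxE (bigD1 j) //= big1 => [|m mi]; last by rewrite mxE (negPf mi) andbF mul0r.
by rewrite mxE eqxx andbT addr0; case: eqP => _; rewrite ?mul1r ?mul0r.
Qed.

End Support.

(** * Unitriangular matrices and their strictly upper triangular parts *)

Section Unitriangular.
Variables (F : fieldType) (N : nat).
Local Notation M := 'M[F]_N.+1.
Local Notation G := (UT N.+1 F).
Implicit Types g h x y w : G.

(* Locked, like [of_npart] below, as unification would otherwise unfold it when rewriting
   with ring laws. *)
Definition npart g : M := locked (val g - 1%:M).

Lemma npartE g : npart g = val g - 1%:M.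
Proof. by rewrite /npart -lock. Qed.

Lemma valE g : val g = 1%:M + npart g. Proof. by rewrite npartE addrC subrK. Qed.

Lemma npart_inj : injective npart.
Proof. by move=> x y e; apply/val_inj; rewrite !valE e. Qed.

Lemma npart_supp g : supp ltn (npart g).
Proof.
move=> i j; apply: contra_neqT; rewrite -leqNgt => leji.
by rewrite npartE !mxE (is_unitrig_mxP _ (UTvalP g)) // subrr.
Qed.

Lemma npart_low g (i j : 'I_N.+1) : (j <= i)%N -> npart g i j = 0.
Proof. by move=> leji; apply: (supp0 (@npart_supp g)); rewrite -leqNgt. Qed.

Definition of_npart (A : M) : G := locked (insubd (1%g : G) (1%:M + A)).

Lemma npart_of_npart A : supp ltn A -> npart (of_npart A) = A.
Proof.
move=> sA; rewrite npartE /of_npart -lock val_insubd ifT; first by rewrite addrC addKr.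
apply/is_unitrig_mxP => i j leji.
by rewrite !mxE (supp0 sA) ?addr0 // -leqNgt.
Qed.

Lemma valM x y : val (x * y)%g = val x *m val y. Proof. by []. Qed.

Lemma npartM x y : npart (x * y)%g = npart x + npart y + npart x *m npart y.
Proof.
rewrite npartE valM [val x]valE [val y]valE mulmxDl !mulmxDr !mul1mx mulmx1.
by apply/matrixP => i j; rewrite !mxE; ring.
Qed.

Lemma comm_npart x y : (x * y = y * x)%g <-> npart x *m npart y = npart y *m npart x.
Proof.
split=> [/(congr1 npart)|e].
  by rewrite !npartM [npart y + _]addrC => /addrI.
by apply: npart_inj; rewrite !npartM e [npart y + _]addrC.
Qed.

(** Replaces the group commutator by the additive one, up to a unitriangular left factor that
    [supp_cancel] removes when only supports matter. *)
Lemma commw_npart x y w : (x * y = y * x * w)%g <->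
  val (y * x)%g *m npart w = npart x *m npart y - npart y *m npart x.
Proof.
have -> : val (y * x)%g *m npart w = npart (y * x * w)%g - npart (y * x)%g.
  by rewrite npartM [val _]valE mulmxDl mul1mx [RHS]addrC -!addrA addKr.
have -> : npart x *m npart y - npart y *m npart x = npart (x * y)%g - npart (y * x)%g.
  by rewrite !npartM [npart y + _]addrC opprD addrACA subrr add0r.
by split=> [->|/addIr/npart_inj].
Qed.

Definition up_closed (T : nat -> nat -> bool) :=
  forall i k j, (i <= k)%N -> T k j -> T i j.

(** Row [i] of [val g *m A] is row [i] of [A] plus multiples of lower rows of [A], so supports are
    recovered from the bottom row upwards. *)
Lemma supp_cancel T g A : up_closed T -> supp T (val g *m A) -> supp T A.
Proof.
move=> upT TgA i j; have [m] := ubnP (N.+1 - i)%N.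
elim: m => // m IHm in i j *; rewrite ltnS => lem.
apply: contra_neqT => nT; have /eqP := supp0 TgA nT.
rewrite valE mulmxDl mul1mx !mxE big1 ?addr0 => [/eqP//|k _].
have [/npart_supp ltik|/negbNE/eqP->] := boolP (npart g i k != 0); last by rewrite mul0r.
suff /eqP-> : A k j == 0 by rewrite mulr0.
apply: contraNT nT => /IHm Tkj; apply: upT (ltnW ltik) (Tkj _).
by apply: leq_trans lem; rewrite ltn_sub2l.
Qed.

Definition elem (i j : 'I_N.+1) (c : F) : G := of_npart (c *: delta_mx i j).

Lemma npart_elem (i j : 'I_N.+1) c : (i < j)%N -> npart (elem i j c) = c *: delta_mx i j.
Proof. by move=> ltij; rewrite npart_of_npart //; apply: supp_delta. Qed.

Lemma comm_elem (i k j : 'I_N.+1) c : (i < k)%N -> (k < j)%N ->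
  (elem i k c * elem k j 1 = elem k j 1 * elem i k c * elem i j c)%g.
Proof.
move=> ltik ltkj; have ltij := ltn_trans ltik ltkj.
have ne (a b : 'I_N.+1) : (a < b)%N -> (b == a) = false by move=> ab; rewrite -val_eqE gtn_eqF.
apply/commw_npart; rewrite valE npartM !npart_elem // !scale1r.
rewrite !mulmxDl !mul1mx -!scalemxAl -!scalemxAr -?mulmxA.
have E (a b a' b' : 'I_N.+1) : (b == a') = false ->
    delta_mx a b *m delta_mx a' b' = 0 :> 'M[F]_N.+1.
  by move=> ba; rewrite mul_delta_mx_0 ?ba.
rewrite !(E k j) ?ne // (E i k i j) ?ne // mul_delta_mx.
by rewrite ?(mulmx0, mul0mx, scaler0, addr0, subr0).
Qed.

(** Compare column [l], respectively row [k], of the two products: the opposite side contributes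
    only diagonal entries of [npart g], which vanish. *)
Lemma comm_elemP g (k l : 'I_N.+1) : (k < l)%N -> (g * elem k l 1 = elem k l 1 * g)%g ->
  (forall i, npart g i k = 0) /\ (forall j, npart g l j = 0).
Proof.
move=> ltkl /comm_npart; rewrite npart_elem // scale1r => /matrixP e.
split=> i; [have := e i l | have := e k i];
  rewrite mulmx_deltar mulmx_deltal eqxx.
  by move=> ->; rewrite npart_low ?if_same.
by move=> <-; rewrite npart_low ?if_same.
Qed.
End Unitriangular.

(** * Subgroups preserved by automorphisms *)

Section Commutators.
Variables (F : fieldType) (N : nat).
Local Notation M := 'M[F]_N.+1.
Local Notation G := (UT N.+1 F).
Implicit Types (g h x y w : G) (P S D : G -> Prop).

(* [lcs P m] is the set of simple commutators of weight [m.+1] in elements of [P]; the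
   commutator [w] of [x] and [y] is specified by [x * y = y * x * w]. *)
Fixpoint lcs P m w : Prop :=
  if m is m'.+1 then exists x y, [/\ lcs P m' x, P y & (x * y = y * x * w)%g]
  else P w.

Definition cent S g := forall w, S w -> (g * w = w * g)%g.

Definition comms D S w := exists x y, [/\ D x, S y & (x * y = y * x * w)%g].

Definition pat (T : nat -> nat -> bool) g := supp T (npart g).

(* Truncated heights: [pat (above e e' 1)] is the group of unitriangular matrices whose first
   [e.+1] and last [e'.+1] rows and columns carry identity blocks. *)
Definition ht e e' (i : nat) := minn (maxn e i) (N - e').
Definition above (e e' m i j : nat) := (ht e e' i + m <= ht e e' j)%N.

(** Height gains add up along the nonzero terms of a matrix product. *)
Lemma lcs_pat e e' m w : lcs (pat (above e e' 1)) m w -> pat (above e e' m.+1) w.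
Proof.
elim: m w => // m IHm w [x [y [/IHm xP yP /commw_npart e1]]].
apply: (@supp_cancel _ _ _ (y * x)%g).
  by move=> i k j; rewrite /above /ht; lia.
by rewrite e1; apply: suppB; [apply: (suppM xP yP)|apply: (suppM yP xP)];
  move=> i k j; rewrite /above; lia.
Qed.

Lemma lcs_elem e e' m (i j : 'I_N.+1) c : above e e' m.+1 i j ->
  lcs (pat (above e e' 1)) m (elem i j c).
Proof.
elim: m i j c => [|m IHm] i j c Hij.
  have ltij : (i < j)%N by move: Hij; rewrite /above /ht; lia.
  by rewrite /= /pat npart_elem //; apply: supp_delta.
(* The index [k] has height one less than [j], so the last commutator uses up exactly one unit of
   the height gain. *)
have ltk : ((ht e e' j).-1 < N.+1)%N by rewrite /ht; lia.
pose k := Ordinal ltk.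
have [Hik Hkj] : above e e' m.+1 i k /\ above e e' 1 k j.
  move: Hij; rewrite /above /= /ht; have := ltn_ord i; have := ltn_ord j; lia.
exists (elem i k c), (elem k j 1); split; first exact: IHm.
  have ltkj : (k < j)%N by move: Hkj; rewrite /above /ht; lia.
  by rewrite /= /pat npart_elem //; apply: supp_delta.
by apply: comm_elem; [move: Hik|move: Hkj]; rewrite /above /ht; lia.
Qed.

Definition rect a b (i j : nat) := (i < a)%N && (b <= j)%N.

(** The elements [elem ord0 i 1] with [i >= e + m.+1] and [elem j ord_max 1] with [j < N - m] are
    commutators of weight [m.+1]; commuting with them kills row [i] and column [j]. Conversely, the
    remaining rectangle leaves no room for a height gain of [m.+1] on either side. *)
Lemma cent_lcs e m g : (e + m < N)%N -> pat (above e 0 1) g ->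
  cent (lcs (pat (above e 0 1)) m) g <-> pat (rect (e + m.+1) (N - m)) g.
Proof.
move=> ltem gP; split=> [gC|gR w /lcs_pat wP].
  move=> i j nz; apply/andP; split.
    rewrite ltnNge; apply: contra_neqN nz => lei.
    have Hi : above e 0 m.+1 (ord0 : 'I_N.+1) i.
      by rewrite /above /ht /=; have := ltn_ord i; lia.
    have lt0i : ((ord0 : 'I_N.+1) < i)%N by move: lei => /=; lia.
    by have [_ ->] := comm_elemP lt0i (gC _ (lcs_elem _ Hi)).
  rewrite leqNgt; apply: contra_neqN nz => ltj.
  have Hj : above e 0 m.+1 j (ord_max : 'I_N.+1).
    by rewrite /above /ht /=; lia.
  have ltjN : (j < (ord_max : 'I_N.+1))%N by move: ltj => /=; lia.
  by have [-> _] := comm_elemP ltjN (gC _ (lcs_elem _ Hj)).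
apply/comm_npart; rewrite (suppM0 gR wP) ?(suppM0 wP gR) //;
  move=> i k j; rewrite /above /rect /ht; lia.
Qed.

Definition right_cols a (i j : nat) := (a <= j)%N.
Definition left_rows a (i j : nat) := (i < a)%N.

(** A gain of [k.+1] from column [b] can only reach column [N], so these commutators live in the
    first [a] rows of the last column. Commuting with all of them means having zero columns before
    [a]. *)
Lemma cent_comms e k a b g : (a <= b)%N -> (a <= e + k.+1)%N -> (e <= b)%N ->
    (b + k.+1 = N)%N ->
  cent (comms (pat (rect a b)) (lcs (pat (above e 0 1)) k)) g <->
  pat (right_cols a) g.
Proof.
move=> leab lea leeb eqN; split=> [gC i j nz|gR w [y [x [yD /lcs_pat xP]]]].
  rewrite /right_cols leqNgt; apply: contra_neqN nz => ltj.
  (* Column [b] is the pivot: [elem j ord_max 1] is the commutator of [elem j o 1] and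
     [elem o ord_max 1]. *)
  have ltb : (b < N.+1)%N by lia.
  pose o := Ordinal ltb.
  have Ho : above e 0 k.+1 o (ord_max : 'I_N.+1) by rewrite /above /ht /=; lia.
  have ltjo : (j < o)%N by rewrite /=; lia.
  have ltoN : (o < (ord_max : 'I_N.+1))%N by rewrite /=; lia.
  have [|->//] := comm_elemP (ltn_trans ltjo ltoN) (g := g).
  apply: gC; exists (elem j o 1), (elem o ord_max 1); split.
  - by rewrite /pat npart_elem //; apply: supp_delta; rewrite /rect ltj /=.
  - exact: lcs_elem.
  - exact: comm_elem.
move/commw_npart => ew.
have wR : pat (rect a N) w.
  apply: (@supp_cancel _ _ _ (x * y)%g).
    by move=> i l j; rewrite /rect; lia.
  rewrite ew (suppM0 xP yD) ?subr0.
    by apply: (suppM yD xP) => i l j; rewrite /rect /above /ht; lia.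
  by move=> i l j; rewrite /rect /above /ht; lia.
apply/comm_npart; rewrite (suppM0 gR wR) ?(suppM0 wR (@npart_supp _ _ g)) //;
  move=> i l j; rewrite /rect /right_cols /=; lia.
Qed.

(** In a strictly upper triangular matrix, (0,1) is the only entry of column 1 and (N-1,N) the only
    one of row N-1, so exactly these two coordinates are required to vanish. *)
Definition cornerless q := pat (rect N.-1 2) q.
Definition corner y := pat (rect 3 (N - 2)) y.

(* The action of [g] on the upper right 3 x 3 corner separates the coordinates (0,1) and
   (N-1,N) of [g]: the commutators of [g] with [cornerless] elements shift the corner upwards
   by two rows if the former coordinate is nonzero and rightwards by two columns if the latter
   is, and the two shifts compose nontrivially. *)
Definition end_degenerate g := forall q q' y k k' v,
  cornerless q -> cornerless q' -> corner y ->
  (q * g = g * q * k)%g -> (q' * g = g * q' * k')%g ->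
  (k' * y = y * k' * v)%g -> (k * v = v * k)%g.

(** For the height that identifies indices 0 and 1, [k] and [k'] gain at least 2. Hence [k'] cannot
    move the corner upwards, [v] is confined to the first three rows of the last column, and there
    [k] acts trivially. *)
Lemma end_degenerate_above10 g : (4 < N)%N -> pat (above 1 0 1) g -> end_degenerate g.
Proof.
move=> N5 gP q q' y k k' v qQ q'Q yN Dk Dk' /commw_npart Dv.
have kP x l : cornerless x -> (x * g = g * x * l)%g -> pat (above 1 0 2) l.
  move=> xQ Dl; apply: (@lcs_pat 1 0 1); exists x, g; split=> // i j xij.
  have := xQ i j xij; have := npart_supp xij.
  by rewrite /rect /above /ht /=; have := ltn_ord j; lia.
have {qQ Dk} kP1 := kP _ _ qQ Dk; have {q'Q Dk'} kP2 := kP _ _ q'Q Dk'.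
have vP : pat (rect 3 N) v.
  apply: (@supp_cancel _ _ _ (y * k')%g).
    by move=> i l j; rewrite /rect; lia.
  rewrite Dv (suppM0 kP2 yN) ?sub0r.
    by apply/suppN/(suppM yN kP2) => i l j; rewrite /rect /above /ht; lia.
  by move=> i l j; rewrite /rect /above /ht; lia.
apply/comm_npart; rewrite (suppM0 kP1 vP) ?(suppM0 vP kP1) //;
  by move=> i l j; rewrite /rect /above /ht; lia.
Qed.

(** Mirror image: identifying indices N-1 and N prevents [k'] from moving the corner rightwards, so
    [v] is confined to row 0. *)
Lemma end_degenerate_above01 g : (4 < N)%N -> pat (above 0 1 1) g -> end_degenerate g.
Proof.
move=> N5 gP q q' y k k' v qQ q'Q yN Dk Dk' /commw_npart Dv.
have kP x l : cornerless x -> (x * g = g * x * l)%g -> pat (above 0 1 2) l.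
  move=> xQ Dl; apply: (@lcs_pat 0 1 1); exists x, g; split=> // i j xij.
  have := xQ i j xij; have := npart_supp xij.
  by rewrite /rect /above /ht /=; have := ltn_ord j; lia.
have {qQ Dk} kP1 := kP _ _ qQ Dk; have {q'Q Dk'} kP2 := kP _ _ q'Q Dk'.
have vP : pat (rect 1 (N - 2)) v.
  apply: (@supp_cancel _ _ _ (y * k')%g).
    by move=> i l j; rewrite /rect; lia.
  rewrite Dv (suppM0 yN kP2) ?subr0.
    by apply: (suppM kP2 yN) => i l j; rewrite /rect /above /ht; lia.
  by move=> i l j; rewrite /rect /above /ht; lia.
apply/comm_npart; rewrite (suppM0 kP1 vP) ?(suppM0 vP kP1) //;
  by move=> i l j; rewrite /rect /above /ht; lia.
Qed.

Lemma end_degenerateP g : (4 < N)%N ->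
  end_degenerate g <-> pat (above 1 0 1) g \/ pat (above 0 1 1) g.
Proof.
move=> N5; split=> [gE|[]]; last 2 first.
- exact: end_degenerate_above10.
- exact: end_degenerate_above01.
have oE k : (k <= N)%N -> (inord k : 'I_N.+1) = k :> nat by move=> lek; rewrite inordK.
pose o k : 'I_N.+1 := inord k.
have e0 : o 0 = 0 :> nat by apply: oE.
have e1 : o 1 = 1 :> nat by apply: oE; lia.
have e2 : o 2 = 2 :> nat by apply: oE; lia.
have ea : o (N - 2)%N = (N - 2)%N :> nat by apply: oE; lia.
have eb : o (N - 1)%N = (N - 1)%N :> nat by apply: oE; lia.
have eN : o N = N :> nat by apply: oE.
move: (o 0) (o 1) (o 2) (o (N - 2)%N) (o (N - 1)%N) (o N) e0 e1 e2 ea eb eN =>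
  o0 o1 o2 oa ob oN e0 e1 e2 ea eb eN {o oE}.
have [g01|g01] := eqVneq (npart g o0 o1) 0.
  left=> i j gij; have := npart_supp gij; rewrite /above /ht /= => ltij.
  suff : ~~ ((i == o0) && (j == o1)) by rewrite -!val_eqE /= e0 e1; have := ltn_ord j; lia.
  by apply: contraNN gij => /andP[/eqP-> /eqP->]; rewrite g01.
have [gbN|gbN] := eqVneq (npart g ob oN) 0.
  right=> i j gij; have := npart_supp gij; rewrite /above /ht /= => ltij.
  suff : ~~ ((i == ob) && (j == oN)) by rewrite -!val_eqE /= eb eN; have := ltn_ord j; lia.
  by apply: contraNN gij => /andP[/eqP-> /eqP->]; rewrite gbN.
case/eqP: g01; set t := npart g ob oN in gbN.
have lt12 : (o1 < o2)%N by lia. have ltab : (oa < ob)%N by lia.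
have lt2a : (o2 < oa)%N by lia. have lt2N : (o2 < oN)%N by lia.
(* [q] is chosen to detect the entry (0,1) of [g], [q'] to detect [t], and [y] joins the two
   ends. *)
pose q := elem o1 o2 (1 : F); pose q' := elem oa ob (1 : F); pose y := elem o2 oa (1 : F).
pose k := ((g * q)^-1 * (q * g))%g; pose k' := ((g * q')^-1 * (q' * g))%g.
have Dk : (q * g = g * q * k)%g by rewrite /k mulVKg.
have Dk' : (q' * g = g * q' * k')%g by rewrite /k' mulVKg.
have Dq' := (commw_npart _ _ _).1 Dk'; rewrite npart_elem // scale1r in Dq'.
have k'P : supp (fun i j => (i <= oa) && (ob <= j))%N (npart k').
  apply: (@supp_cancel _ _ _ (g * q')%g); first by move=> i l j; lia.
  rewrite Dq' => i j; rewrite mxE mulmx_deltal [X in _ + X]mxE mulmx_deltar.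
  have [-> /=|_] := eqVneq i oa; have [-> /=|_] := eqVneq j ob; rewrite ?leqnn //.
  - rewrite subr0 => /npart_supp /=; lia.
  - rewrite sub0r oppr_eq0 => /npart_supp /=; lia.
  by rewrite subrr eqxx.
have k'a : delta_mx o2 oa *m npart k' = t *: delta_mx o2 oN.
  apply/matrixP => i j; rewrite mulmx_deltal !mxE.
  have [_ /=|_] := eqVneq i o2; last by rewrite mulr0.
  have := congr1 (fun A : M => A oa j) Dq'.
  rewrite [val _]valE mulmxDl mul1mx mxE [X in _ + X]mxE big1 => [|l _]; last first.
    have [/npart_supp /= ltal|/negbNE/eqP->] := boolP (npart (g * q')%g oa l != 0).
      by rewrite (supp0 k'P) ?mulr0 //=; lia.
    by rewrite mul0r.
  rewrite addr0 => ->; rewrite mxE mulmx_deltal eqxx [X in _ + X]mxE mulmx_deltar.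
  rewrite (@npart_low _ _ _ oa) // if_same subr0.
  have [->|nejN] := eqVneq j oN; first by rewrite mulr1.
  rewrite mulr0 npart_low //.
  by move: nejN; rewrite -val_eqE /= eN; have := ltn_ord j; lia.
(* Row N-2 of [npart k'] is [t] in column N and zero elsewhere, while [npart k'] kills [y] from the
   left; this gives the coefficient [- t]. *)
pose v := elem o2 oN (- t).
have Dv : (k' * y = y * k' * v)%g.
  apply/commw_npart; rewrite !npart_elem // scale1r k'a.
  have -> : npart k' *m delta_mx o2 oa = 0.
    apply/matrixP => i j; rewrite mulmx_deltar (supp0 k'P) /= ?if_same ?mxE //; lia.
  rewrite sub0r valE npartM mulmxDl mul1mx -scalemxAr.
  suff -> : (npart y + npart k' + npart y *m npart k') *m delta_mx o2 oN = 0.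
    by rewrite scaler0 addr0 scaleNr.
  apply/matrixP => i j; rewrite mulmx_deltar npart_elem // scale1r k'a !mxE.
  rewrite (supp0 k'P) /=; last by lia.
  have -> : (o2 == oa) = false by rewrite -val_eqE ltn_eqF.
  have -> : (o2 == oN) = false by rewrite -val_eqE ltn_eqF.
  by rewrite !andbF mulr0 !addr0 if_same.
have qQ : cornerless q.
  by rewrite /cornerless /pat npart_elem //; apply: supp_delta; rewrite /rect; lia.
have q'Q : cornerless q'.
  by rewrite /cornerless /pat npart_elem //; apply: supp_delta; rewrite /rect; lia.
have yN : corner y.
  by rewrite /corner /pat npart_elem //; apply: supp_delta; rewrite /rect; lia.
have /comm_npart := gE _ _ _ _ _ _ qQ q'Q yN Dk Dk' Dv.
rewrite npart_elem // -scalemxAr -scalemxAl => /scalerI.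
rewrite oppr_eq0 => /(_ gbN) ekv.
(* As [t] is nonzero, commuting with [v] kills column 2 of [npart k]. The entry (0,2) of the
   additive commutator of [q] and [g] is minus the entry (0,1) of [g], which therefore vanishes. *)
have k2 i : npart k i o2 = 0.
  have := congr1 (fun A : M => A i oN) ekv.
  rewrite mulmx_deltar mulmx_deltal eqxx => ->.
  by rewrite npart_low ?if_same // eN; have := ltn_ord o2; lia.
have := congr1 (fun A : M => A o0 o2) ((commw_npart _ _ _).1 Dk).
rewrite [LHS]mxE big1 => [|l _]; last by rewrite k2 mulr0.
rewrite npart_elem // scale1r mxE mulmx_deltal [X in _ + X]mxE mulmx_deltar eqxx.
have -> : (o0 == o1) = false by rewrite -val_eqE /= e0 e1.
by rewrite sub0r => /esym/eqP; rewrite oppr_eq0 => /eqP.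
Qed.
End Commutators.

(** * Invariance under automorphisms, and the two end coordinates *)

Section Invariance.
Variables (F : fieldType) (N : nat).
Local Notation M := 'M[F]_N.+1.
Local Notation G := (UT N.+1 F).
Local Notation above := (above N).
Implicit Types (g h x y w : G) (P S D : G -> Prop) (f : G -> G).

Definition is_aut f := bijective f /\ {morph f : x y / (x * y)%g}.
Definition preserves f S := forall g, S (f g) <-> S g.

Lemma is_aut_comp f1 f2 : is_aut f1 -> is_aut f2 -> is_aut (f1 \o f2).
Proof. by move=> [b1 m1] [b2 m2]; split; [apply: bij_comp|move=> x y /=; rewrite m2 m1]. Qed.

Lemma is_aut_inv f : is_aut f -> exists f', [/\ is_aut f', cancel f f' & cancel f' f].
Proof.
move=> [[f' fK f'K] fM]; exists f'; split=> //; split; first by exists f.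
by move=> x y; apply: (can_inj fK); rewrite fM !f'K.
Qed.

Lemma preserves_eq f S S' : (forall g, S g <-> S' g) -> preserves f S -> preserves f S'.
Proof. by move=> SS' fS g; rewrite -SS' fS SS'. Qed.

Lemma preserves_and f S S' : preserves f S -> preserves f S' -> preserves f (fun g => S g /\ S' g).
Proof. by move=> fS fS' g; rewrite fS fS'. Qed.

Section OneAut.
Variable f : G -> G.
Hypothesis fA : is_aut f.

Let fM x y : f (x * y)%g = (f x * f y)%g. Proof. by case: fA => _ ->. Qed.
Let fI : injective f. Proof. by case: fA => /bij_inj. Qed.
Let f_onto y : exists x, y = f x.
Proof. by case: fA => [[f' _ f'K] _]; exists (f' y). Qed.

Lemma preserves_cent S : preserves f S -> preserves f (cent S).
Proof.
move=> fS g; split=> gC w Sw; first by apply: fI; rewrite !fM gC ?fS.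
by have [x Dw] := f_onto w; rewrite Dw -!fM gC // -fS -Dw.
Qed.

Lemma preserves_comms D S : preserves f D -> preserves f S -> preserves f (comms D S).
Proof.
move=> fD fS w; split=> [[x [y [Dx Sy e]]]|[x [y [Dx Sy e]]]]; last first.
  by exists (f x), (f y); split; rewrite ?fD ?fS // -!fM e.
have [x' Dx'] := f_onto x; have [y' Dy'] := f_onto y.
exists x', y'; split; [by rewrite -fD -Dx' | by rewrite -fS -Dy' |].
by apply: fI; rewrite !fM -Dx' -Dy'.
Qed.

Lemma preserves_lcs P m : preserves f P -> preserves f (lcs P m).
Proof. by move=> fP; elim: m => // m IHm; apply: (preserves_comms IHm fP). Qed.

Lemma preserves_end_degenerate :
  preserves f (@cornerless F N) -> preserves f (@corner F N) -> preserves f (@end_degenerate F N).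
Proof.
move=> fQ fC g; split=> gE q q' y k k' v qQ q'Q yC Dk Dk' Dv.
  by apply: fI; rewrite !fM; apply: (gE (f q) (f q') (f y) _ (f k')); rewrite ?fQ ?fC // -!fM;
     congr f.
have [q1 D1] := f_onto q; have [q2 D2] := f_onto q'; have [y1 D3] := f_onto y.
have [k1 D4] := f_onto k; have [k2 D5] := f_onto k'; have [v1 D6] := f_onto v.
subst q q' y k k' v; move: Dk Dk' Dv; rewrite -!fM => /fI Dk /fI Dk' /fI Dv.
by congr f; apply: gE Dk Dk' Dv; [rewrite -fQ|rewrite -fQ|rewrite -fC].
Qed.

End OneAut.

Lemma above00 g : pat (above 0 0 1) g.
Proof.
by move=> i j /npart_supp; rewrite /above /ht /=; have := ltn_ord j; lia.
Qed.

(** [cent_lcs] describes the centralizer inside [pat (above e 0 1)]; the alternative in the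
    hypotheses puts the whole rectangle into that group. *)
Lemma preserves_cent_lcs f e m : is_aut f -> (e + m < N)%N -> (e + m.+1 <= N - m)%N \/ e = 0 ->
  preserves f (pat (above e 0 1)) -> preserves f (pat (rect (e + m.+1) (N - m))).
Proof.
move=> fA ltem cond fP.
apply: (preserves_eq _ (preserves_and fP (preserves_cent fA (preserves_lcs fA m fP)))) => g.
split=> [[gP]|gR]; first by rewrite cent_lcs.
suff gP : pat (above e 0 1) g by split=> //; rewrite cent_lcs.
case: cond => [le|->]; last exact: above00.
by move=> i j gij; have := gR i j gij; rewrite /rect /above /ht; have := ltn_ord j; lia.
Qed.

Lemma preserves_corner f : is_aut f -> (4 < N)%N -> preserves f (@corner F N).
Proof.
move=> fA N5; apply: (@preserves_cent_lcs f 0 2) => //; [lia | by right |].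
by move=> g; split=> _; apply: above00.
Qed.

Lemma preserves_cornerless f : is_aut f -> (4 < N)%N -> preserves f (@cornerless F N).
Proof.
move=> fA N5; have := @preserves_cent_lcs f 0 (N - 2) fA.
rewrite (_ : 0 + (N - 2).+1 = N.-1)%N; last by lia.
rewrite (_ : N - (N - 2) = 2)%N; last by lia.
apply; [lia | by right |].
by move=> g; split=> _; apply: above00.
Qed.

Definition first_coord g := npart g ord0 (inord 1).
Definition last_coord g := npart g (inord N.-1) ord_max.

Lemma above10P g : (4 < N)%N -> pat (above 1 0 1) g <-> first_coord g = 0.
Proof.
move=> N5; have e1 : (inord 1 : 'I_N.+1) = 1 :> nat by rewrite inordK //; lia.
split=> [gP|g01 i j gij].
  by apply: (supp0 gP); rewrite e1 /above /ht /=; lia.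
have := npart_supp gij; rewrite /above /ht /= => ltij.
suff : ~~ ((i == ord0) && (j == inord 1)).
  by rewrite -!val_eqE /= e1; have := ltn_ord j; lia.
by apply: contraNN gij => /andP[/eqP-> /eqP->]; apply/eqP.
Qed.

Lemma above01P g : (4 < N)%N -> pat (above 0 1 1) g <-> last_coord g = 0.
Proof.
move=> N5; have e1 : (inord N.-1 : 'I_N.+1) = N.-1 :> nat by rewrite inordK //; lia.
split=> [gP|g01 i j gij].
  by apply: (supp0 gP); rewrite e1 /above /ht /=; lia.
have := npart_supp gij; rewrite /above /ht /= => ltij.
suff : ~~ ((i == inord N.-1) && (j == ord_max)).
  by rewrite -!val_eqE /= e1; have := ltn_ord j; lia.
by apply: contraNN gij => /andP[/eqP-> /eqP->]; apply/eqP.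
Qed.
End Invariance.

(** * Automorphisms that keep or swap the two ends *)

Section Straight.
Variables (F : fieldType) (N : nat).
Local Notation M := 'M[F]_N.+1.
Local Notation G := (UT N.+1 F).
Local Notation above := (above N).
Implicit Types (g h x y w : G) (P S D : G -> Prop) (f : G -> G).

Lemma first_coordM : {morph @first_coord F N : x y / (x * y)%g >-> x + y}.
Proof.
move=> x y; rewrite /first_coord npartM !mxE big1 ?addr0 // => k _.
have [->|k0] := eqVneq k ord0; first by rewrite npart_low ?mul0r.
rewrite [X in _ * X]npart_low ?mulr0 //; move: k0; rewrite -val_eqE /=.
by have := ltn_ord k; case: N => [|n] in k *; [lia | rewrite inordK //; lia].
Qed.

Lemma last_coordM : {morph @last_coord F N : x y / (x * y)%g >-> x + y}.
Proof.
move=> x y; rewrite /last_coord npartM !mxE big1 ?addr0 // => k _.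
have [->|kN] := eqVneq k ord_max; first by rewrite [X in _ * X]npart_low ?mulr0.
rewrite npart_low ?mul0r //; move: kN; rewrite -val_eqE /= inordK; last by lia.
by have := ltn_ord k; lia.
Qed.

(** Stated for arbitrary [u] and [v] so as to cover both orders of the end coordinates. *)
Lemma coord_rigid f (a b u v : G -> F) x0 :
    {morph f : x y / (x * y)%g} ->
    {morph a : x y / (x * y)%g >-> x + y} -> {morph b : x y / (x * y)%g >-> x + y} ->
    {morph u : x y / (x * y)%g >-> x + y} ->
    (forall g, u (f g) = 0 \/ v (f g) = 0 <-> a g = 0 \/ b g = 0) ->
    (forall g, u (f g) = 0 /\ v (f g) = 0 <-> a g = 0 /\ b g = 0) ->
    a x0 = 0 -> b x0 <> 0 -> (forall g, a g = 0 -> u (f g) = 0) ->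
  forall g, (u (f g) = 0 <-> a g = 0) /\ (v (f g) = 0 <-> b g = 0).
Proof.
move=> fM aM bM uM H1 H2 ax bx au.
have bv g : b g = 0 -> v (f g) = 0.
  move=> bg; have [ug|//] := (H1 g).2 (or_intror bg).
  have [ag|ag] := eqVneq (a g) 0; first by case: ((H2 g).2 (conj ag bg)).
  have := H1 (g * x0)%g; rewrite fM uM aM bM ug (au _ ax) ax bg !addr0 !add0r.
  by case=> /(_ (or_introl erefl)) [/eqP|/bx //]; rewrite (negPf ag).
move=> g; split; split; [|exact: au| |exact: bv] => e.
  have [//|bg] := (H1 g).1 (or_introl e).
  by case: ((H2 g).1 (conj e (bv _ bg))).
have [ag|//] := (H1 g).1 (or_intror e).
by case: ((H2 g).1 (conj (au _ ag) e)).
Qed.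

Lemma last_coord_witness : (4 < N)%N ->
  exists2 x0 : G, first_coord x0 = 0 & last_coord x0 <> 0.
Proof.
move=> N5; have eN1 : (inord N.-1 : 'I_N.+1) = N.-1 :> nat by rewrite inordK //; lia.
have ltN : ((inord N.-1 : 'I_N.+1) < (ord_max : 'I_N.+1))%N by rewrite eN1 /=; lia.
exists (elem (inord N.-1) ord_max 1).
  rewrite /first_coord npart_elem // !mxE -val_eqE /= eN1.
  by rewrite (_ : 0%N == N.-1 = false) ?mulr0 //; lia.
by apply/eqP; rewrite /last_coord npart_elem // !mxE !eqxx mulr1 oner_eq0.
Qed.

Definition straight f := preserves f (pat (above 1 0 1)) /\ preserves f (pat (above 0 1 1)).
Definition swapped f := forall g, pat (above 0 1 1) (f g) <-> pat (above 1 0 1) g.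

(** [f] maps the kernel of [a] into the union of the kernels of [a] and [b]; a group is not the
    union of two proper subgroups, so one of the two contains the image. *)
Lemma straight_or_swapped f : (4 < N)%N -> is_aut f -> straight f \/ swapped f.
Proof.
move=> N5 fA; have fM : {morph f : x y / (x * y)%g} by case: fA.
pose a : G -> F := @first_coord F N; pose b : G -> F := @last_coord F N.
have aM : {morph a : x y / (x * y)%g >-> x + y} := @first_coordM.
have bM : {morph b : x y / (x * y)%g >-> x + y} := @last_coordM.
have fQ := preserves_cornerless fA N5.
have fE := preserves_end_degenerate fA fQ (preserves_corner fA N5).
have H1 g : a (f g) = 0 \/ b (f g) = 0 <-> a g = 0 \/ b g = 0.
  by rewrite -!above10P // -!above01P // -!end_degenerateP.
have QP g : cornerless g <-> a g = 0 /\ b g = 0.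
  rewrite -above10P // -above01P //; split=> [gQ|[ga gb] i j gij]; last first.
    have := ga i j gij; have := gb i j gij.
    by rewrite /above /rect /ht; have := ltn_ord j; lia.
  split=> i j gij; have := gQ i j gij; have := npart_supp gij;
  by rewrite /above /rect /ht /=; have := ltn_ord j; lia.
have H2 g : a (f g) = 0 /\ b (f g) = 0 <-> a g = 0 /\ b g = 0 by rewrite -!QP.
have [x0 ax bx] := last_coord_witness N5.
have [au|/existsNP[g1 /not_implyP[a1 /eqP b1]]] :=
    pselect (forall g, a g = 0 -> a (f g) = 0).
  left; have R := coord_rigid fM aM bM aM H1 H2 ax bx au.
  by split=> g; rewrite ?above10P ?above01P //; case: (R g).
have [bu|/existsNP[g2 /not_implyP[a2 /eqP b2]]] :=
    pselect (forall g, a g = 0 -> b (f g) = 0).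
  right; have H1' g : b (f g) = 0 \/ a (f g) = 0 <-> a g = 0 \/ b g = 0.
    by rewrite -H1; split; case; auto.
  have H2' g : b (f g) = 0 /\ a (f g) = 0 <-> a g = 0 /\ b g = 0.
    by rewrite -H2; split; case; auto.
  have R := coord_rigid fM aM bM bM H1' H2' ax bx bu.
  by move=> g; rewrite above10P // above01P //; case: (R g).
have e1 : b (f g1) = 0 by case: ((H1 g1).2 (or_introl a1)) => // /eqP; rewrite (negPf b1).
have e2 : a (f g2) = 0 by case: ((H1 g2).2 (or_introl a2)) => // /eqP; rewrite (negPf b2).
have /H1 : a (g1 * g2)%g = 0 \/ b (g1 * g2)%g = 0 by left; rewrite aM a1 a2 addr0.
rewrite fM aM bM e1 e2 addr0 add0r.
by case=> /eqP; rewrite ?(negPf b1) ?(negPf b2).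
Qed.

Lemma straight_inv f f' : cancel f' f -> straight f -> straight f'.
Proof. by move=> f'K [f1 f2]; split=> g; [rewrite -f1|rewrite -f2]; rewrite f'K. Qed.

(** If the composite were swapped too, the kernels of the two end coordinates would coincide. *)
Lemma swapped_comp f1 f2 f2' : (4 < N)%N -> is_aut f1 -> is_aut f2' -> cancel f2' f2 ->
  swapped f1 -> swapped f2 -> straight (f1 \o f2').
Proof.
move=> N5 f1A f2A f2K s1 s2; have [//|s3] := straight_or_swapped N5 (is_aut_comp f1A f2A).
have JJ g : pat (above 0 1 1) g <-> pat (above 1 0 1) g.
  by rewrite -s3 /= s1 -s2 f2K.
have [x0 /(above10P _ N5)/JJ] := last_coord_witness N5.
by rewrite above01P.
Qed.

(** Reflection in the antidiagonal reverses products; conjugating an automorphism by it exchanges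
    statements on rows and on columns. *)
Definition flip g : G := of_npart (\matrix_(i, j) npart g (rev_ord j) (rev_ord i)).

Lemma npart_flip g (i j : 'I_N.+1) : npart (flip g) i j = npart g (rev_ord j) (rev_ord i).
Proof.
rewrite npart_of_npart ?mxE // => k l; rewrite mxE => /npart_supp /=.
by have := ltn_ord k; have := ltn_ord l; lia.
Qed.

Lemma flipK : involutive flip.
Proof. by move=> g; apply/npart_inj/matrixP => i j; rewrite !npart_flip !rev_ordK. Qed.

Lemma flipM x y : flip (x * y)%g = (flip y * flip x)%g.
Proof.
apply/npart_inj/matrixP => i j; rewrite npart_flip !npartM !mxE !npart_flip.
rewrite [_ + npart x _ _]addrC; congr (_ + _); rewrite (reindex_inj rev_ord_inj).
by apply: eq_bigr => k _; rewrite !npart_flip mulrC.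
Qed.

Definition conj_flip f := flip \o f \o flip.

Lemma conj_flip_aut f : is_aut f -> is_aut (conj_flip f).
Proof.
move=> [bf fM]; have flip_bij : bijective flip by exists flip; apply: flipK.
split; first exact: bij_comp (bij_comp flip_bij bf) flip_bij.
by move=> x y; rewrite /conj_flip /= flipM fM flipM.
Qed.

Lemma pat_flip (T T' : nat -> nat -> bool) g :
  (forall i j, (i <= N)%N -> (j <= N)%N -> T i j = T' (N - j)%N (N - i)%N) ->
  pat T (flip g) <-> pat T' g.
Proof.
move=> TT'; split=> gP i j gij; last first.
  move: gij; rewrite npart_flip => /gP /=.
  by rewrite !subSS TT' // leq_ord.
have := gP (rev_ord j) (rev_ord i); rewrite npart_flip !rev_ordK => /(_ gij).
by rewrite TT' /= !subSS ?leq_subr // !subKn // leq_ord.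
Qed.

Lemma preserves_conj_flip f (T T' : nat -> nat -> bool) :
  (forall i j, (i <= N)%N -> (j <= N)%N -> T i j = T' (N - j)%N (N - i)%N) ->
  preserves f (pat T) -> preserves (conj_flip f) (pat T').
Proof.
move=> TT' fT g; rewrite -(pat_flip _ TT') /conj_flip /= flipK fT.
exact: pat_flip.
Qed.

Lemma straight_flip f : straight f -> straight (conj_flip f).
Proof.
move=> [f1 f2]; split; [apply: preserves_conj_flip f2|apply: preserves_conj_flip f1];
  by move=> i j; rewrite /above /ht; lia.
Qed.

Lemma preserves_right_cols f r s : is_aut f -> straight f -> (4 < N)%N -> N.+1 = (r + s)%N ->
    (2 < r)%N -> (2 < s)%N -> (r <= s.+1)%N -> preserves f (pat (rect r r)) ->
  preserves f (pat (right_cols r)).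
Proof.
move=> fA [fJ _] N5 eN r3 s3 lers fR.
(* First [cent_comms] with a = 3, b = N - 2, e = 1, k = 1 gives the columns from 3 on. This is the
   group [above 2 0 1], and the better start e = 2 then reaches [r <= s.+1]. *)
have fR3 : preserves f (pat (right_cols 3)).
  have fC := preserves_comms fA (preserves_corner fA N5) (preserves_lcs fA 1 fJ).
  apply: (preserves_eq _ (preserves_cent fA fC)).
  by move=> g; apply: cent_comms; lia.
have fP : preserves f (pat (above 2 0 1)).
  apply: preserves_eq fR3 => g; split=> gP i j gij; have := gP i j gij; have := npart_supp gij;
  by rewrite /right_cols /above /ht /=; have := ltn_ord j; lia.
apply: (preserves_eq _ (preserves_cent fA (preserves_comms fA fR (preserves_lcs fA (s - 2) fP)))).
by move=> g; apply: cent_comms; lia.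
Qed.

Lemma straight_blocks f : is_aut f -> straight f -> (4 < N)%N ->
  exists r, [/\ (2 < r)%N, (r + 2 < N.+1)%N, preserves f (pat (rect r r)),
                preserves f (pat (right_cols r)) & preserves f (pat (left_rows r))].
Proof.
(* The cut is in the middle: [r] and [s] are the halves of [N.+1] rounded up and down. For odd size
   the truncation e = 1 compensates the parity, and its invariance is what [straight] supplies. *)
move=> fA sf N5; pose s := (N.+1)./2; pose e : nat := odd N.+1; pose r := (s + e)%N.
have eN : N.+1 = (r + s)%N.
  by rewrite -(odd_double_half N.+1) -/s -/e /r -addnn; lia.
have e1 : (e <= 1)%N by rewrite /e; case: odd.
have fR : preserves f (pat (rect r r)).
  have := @preserves_cent_lcs _ _ f e s.-1 fA.
  rewrite (_ : e + s.-1.+1 = r)%N; last by rewrite /r; lia.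
  rewrite (_ : N - s.-1 = r)%N; last by rewrite /r in eN *; lia.
  apply; [by rewrite /r in eN *; lia | by left |].
  have [->|e0] : e = 1%N \/ e = 0%N by lia.
    by case: sf.
  by rewrite e0 => g; split=> _; apply: above00.
exists r; split=> //; try by rewrite /r in eN *; lia.
  by apply: (@preserves_right_cols f r s) => //; rewrite /r in eN *; lia.
have fR' : preserves (conj_flip f) (pat (rect s s)).
  by apply: preserves_conj_flip fR => i j; rewrite /rect; lia.
have H : preserves (conj_flip f) (pat (right_cols s)).
  apply: (@preserves_right_cols _ s r) => //; try by rewrite /r in eN *; lia.
    exact: conj_flip_aut.
  exact: straight_flip.
have := @preserves_conj_flip (conj_flip f) (right_cols s) (left_rows r).
rewrite /conj_flip /right_cols /left_rows => H'.
move=> g; have := H' _ H g; rewrite /= !flipK; apply.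
by move=> i j; lia.
Qed.
End Straight.

(** * Automorphisms preserving the block structure *)

Section Blocks.
Variables (F : fieldType) (N r : nat).
Local Notation M := 'M[F]_N.+1.
Local Notation G := (UT N.+1 F).
Local Notation E i j := (delta_mx i j : M).
Implicit Types (g x y w : G) (Y Z : M).
Hypotheses (r3 : (2 < r)%N) (rN : (r + 2 < N.+1)%N).
Variable f : G -> G.
Hypotheses (fA : is_aut f) (fR : preserves f (pat (right_cols r)))
  (fL : preserves f (pat (left_rows r))) (fB : preserves f (pat (rect r r))).

Let fM : {morph f : x y / (x * y)%g}. Proof. by case: fA. Qed.
Let f_onto g : exists x, f x = g.
Proof. by case: fA => [[f' _ f'K] _]; exists (f' g). Qed.

Definition block Y := supp (rect r r) Y.
(** On blocks the group law is addition, since products of two blocks vanish; this is the additive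
    map induced by [f]. *)
Definition phi Y : M := npart (f (of_npart Y)).

Lemma block_ltn Y : block Y -> supp ltn Y.
Proof. by move=> bY; apply: (suppW bY) => i j; rewrite /rect /=; lia. Qed.

Lemma phi_block Y : block Y -> block (phi Y).
Proof. by move=> bY; apply/fB; rewrite /pat npart_of_npart //; apply: block_ltn. Qed.

Lemma phiD Y Z : block Y -> block Z -> phi (Y + Z) = phi Y + phi Z.
Proof.
move=> bY bZ; rewrite {1}/phi; have -> : of_npart (Y + Z) = (of_npart Y * of_npart Z)%g.
  apply: npart_inj; rewrite npartM !npart_of_npart; try exact: block_ltn; last first.
    exact/block_ltn/suppD.
  by rewrite (suppM0 bY bZ) ?addr0 // => i k j _ _ _; rewrite /rect; lia.
rewrite fM npartM -/(phi Y) -/(phi Z).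
rewrite (suppM0 (phi_block bY) (phi_block bZ)) ?addr0 //.
by move=> i k j _ _ _; rewrite /rect; lia.
Qed.

Lemma phi0 : phi 0 = 0.
Proof.
have := phiD (supp_zero _) (supp_zero _).
by rewrite addr0 -[X in X = _]addr0 => /addrI.
Qed.

Lemma left_block g Y : pat (left_rows r) g -> block Y -> block (npart g *m Y).
Proof.
move=> gL bY; apply: (suppM gL bY) => i k j _ _ _.
by rewrite /rect /left_rows; lia.
Qed.

Lemma right_block g Y : pat (right_cols r) g -> block Y -> block (Y *m npart g).
Proof.
move=> gR bY; apply: (suppM bY gR) => i k j _ _ _.
by rewrite /rect /right_cols; lia.
Qed.

Let block_left g Y : block Y -> pat (left_rows r) g -> Y *m npart g = 0.
Proof.
move=> bY gL; apply: (suppM0 bY gL) => i k j _ _ _.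
by rewrite /rect /left_rows; lia.
Qed.

Let block_right g Y : block Y -> pat (right_cols r) g -> npart g *m Y = 0.
Proof.
move=> bY gR; apply: (suppM0 gR bY) => i k j _ _ _.
by rewrite /rect /right_cols; lia.
Qed.

(** Conjugation by [g] acts on blocks as left multiplication by [val g], because [Y *m npart g = 0];
    [f] respects conjugation. *)
Lemma phi_left g Y : pat (left_rows r) g -> block Y ->
  phi (npart g *m Y) = npart (f g) *m phi Y.
Proof.
move=> gL bY; have bgY := left_block gL bY.
have e : (g * of_npart Y = of_npart (Y + npart g *m Y) * g)%g.
  apply: npart_inj; rewrite !npartM !npart_of_npart; try exact: block_ltn; last first.
    exact/block_ltn/suppD.
  by rewrite mulmxDl !block_left // !addr0 [RHS]addrC addrA.
have := congr1 (@npart F N) (congr1 f e); rewrite !fM !npartM -/(phi Y) -/(phi (Y + _)) phiD //.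
rewrite mulmxDl !(@block_left (f g)) ?(fL g) //; try exact: phi_block.
by rewrite !addr0 [RHS]addrC addrA => /addrI.
Qed.

Lemma phi_right g Y : pat (right_cols r) g -> block Y ->
  phi (Y *m npart g) = phi Y *m npart (f g).
Proof.
move=> gR bY; have bgY := right_block gR bY.
have e : (of_npart Y * g = g * of_npart (Y + Y *m npart g))%g.
  apply: npart_inj; rewrite !npartM !npart_of_npart; try exact: block_ltn; last first.
    exact/block_ltn/suppD.
  by rewrite mulmxDr !block_right // !addr0 [Y + npart g]addrC -addrA.
have := congr1 (@npart F N) (congr1 f e); rewrite !fM !npartM -/(phi Y) -/(phi (Y + _)) phiD //.
rewrite mulmxDr !(@block_right (f g)) ?(fR g) //; try exact: phi_block.
by rewrite !addr0 [phi Y + npart _]addrC -addrA => /addrI /addrI.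
Qed.

Variables o0 o1 o2 op oq oN : 'I_N.+1.
Hypotheses (e0 : o0 = 0 :> nat) (e1 : o1 = 1 :> nat) (e2 : o2 = 2 :> nat)
  (ep : op = (N - 2)%N :> nat) (eq1 : oq = (N - 1)%N :> nat) (eN : oN = N :> nat).

Definition Xmx (l : F) : M := l *: E o1 op + 1 *: E o1 oq + (1 *: E o2 op + 1 *: E o2 oq).
(* [l] is the cross ratio of the 2 x 2 block of [Xmx l], which rescaling rows and columns
   does not change. *)
Definition cross_ratio_elt (l : F) : G := (elem o0 o1 1 * elem oq oN 1 * of_npart (Xmx l))%g.

Variables l m : F.
Hypothesis ful : f (cross_ratio_elt l) = cross_ratio_elt m.

Variables x y : G.
Hypotheses (Dx : x = elem o0 o1 1) (Dy : y = elem oq oN 1).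
Let a1 := npart (f x).
Let b1 := npart (f y).

Let lt01 : (o0 < o1)%N. Proof. lia. Qed.
Let ltqN : (oq < oN)%N. Proof. lia. Qed.
Let nx : npart x = E o0 o1. Proof. by rewrite Dx npart_elem // scale1r. Qed.
Let ny : npart y = E oq oN. Proof. by rewrite Dy npart_elem // scale1r. Qed.

Let xL : pat (left_rows r) x.
Proof. by rewrite /pat Dx npart_elem //; apply: supp_delta; rewrite /left_rows; lia. Qed.
Let yR : pat (right_cols r) y.
Proof. by rewrite /pat Dy npart_elem //; apply: supp_delta; rewrite /right_cols; lia. Qed.
Let a1L : supp (left_rows r) a1. Proof. exact/fL. Qed.
Let b1R : supp (right_cols r) b1. Proof. exact/fR. Qed.

Lemma block_delta (i j : 'I_N.+1) s : (i < r)%N -> (r <= j)%N -> block (s *: E i j).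
Proof. by move=> ir rj; apply: supp_delta; rewrite /rect ir. Qed.

Let Xblock c : block (Xmx c).
Proof. by do ![apply: suppD]; apply: block_delta; lia. Qed.

Let main_eq :
  a1 + b1 + a1 *m b1 + (phi (Xmx l) + a1 *m phi (Xmx l)) =
  E o0 o1 + E oq oN + (Xmx m + E o0 o1 *m Xmx m).
Proof.
have := congr1 (@npart F N) ful.
rewrite /cross_ratio_elt -Dx -Dy !fM !npartM nx ny npart_of_npart; last exact: block_ltn.
rewrite -/a1 -/b1 -/(phi (Xmx l)) !mulmxDl -!mulmxA -ny.
rewrite (@block_right (f y)) ?(@block_right y) ?fR //; last exact: phi_block.
rewrite !mulmx0 !addr0 -!addrA => ->.
rewrite ny mul_delta_mx_0 ?add0r //.
by rewrite -val_eqE /=; lia.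
Qed.

Let addE (A B : M) i j : (A + B) i j = A i j + B i j. Proof. by rewrite mxE. Qed.

Let main_entry i j : a1 i j + b1 i j + (a1 *m b1) i j
    + (phi (Xmx l) i j + (a1 *m phi (Xmx l)) i j) =
  E o0 o1 i j + E oq oN i j + (Xmx m i j + (E o0 o1 *m Xmx m) i j).
Proof. by have := congr1 (fun A : M => A i j) main_eq; rewrite /= !addE. Qed.

Let right_mul (A B : M) : supp (right_cols r) B -> supp (right_cols r) (A *m B).
Proof. by move=> sB; apply: (@suppM _ _ (fun _ _ => true) _ _ _ _ _ sB). Qed.

Let left_mul (A B : M) : supp (left_rows r) A -> supp (left_rows r) (A *m B).
Proof. by move=> sA; apply: (@suppM _ _ _ (fun _ _ => true) _ _ _ sA). Qed.

Let blockR A : block A -> supp (right_cols r) A.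
Proof. by move=> bA; apply: (suppW bA) => k q; rewrite /rect /right_cols; lia. Qed.

Let blockL A : block A -> supp (left_rows r) A.
Proof. by move=> bA; apply: (suppW bA) => k q; rewrite /rect /left_rows; lia. Qed.

(** All other terms of [main_eq] live in columns from [r] on, or vanish there. *)
Let a1_left (i j : 'I_N.+1) : (j < r)%N -> a1 i j = E o0 o1 i j.
Proof.
move=> jr; have z (A : M) : supp (right_cols r) A -> A i j = 0.
  by move=> sA; apply: (supp0 sA); rewrite /right_cols -ltnNge.
have := main_entry i j; rewrite (z _ b1R) !(z _ (right_mul _)) ?addr0 //; last 2 first.
- exact/blockR/Xblock.
- exact/blockR/phi_block/Xblock.
rewrite (z _ (blockR (@Xblock m))) (z _ (blockR (phi_block (@Xblock l)))) !addr0 => ->.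
rewrite (_ : E oq oN i j = 0) ?addr0 // mxE andbC -(val_eqE j) /=.
by rewrite (_ : (j == oN :> nat) = false) //; lia.
Qed.

Let b1_right (i j : 'I_N.+1) : (r <= i)%N -> b1 i j = E oq oN i j.
Proof.
move=> ir; have z (A : M) : supp (left_rows r) A -> A i j = 0.
  by move=> sA; apply: (supp0 sA); rewrite /left_rows -leqNgt.
have := main_entry i j; rewrite (z _ a1L) !(z _ (left_mul _)) ?addr0 //; last first.
  by rewrite -nx; apply: xL.
rewrite (z _ (blockL (@Xblock m))) (z _ (blockL (phi_block (@Xblock l)))) !addr0 add0r => ->.
rewrite (_ : E o0 o1 i j = 0) ?add0r // mxE -(val_eqE i) /=.
by rewrite (_ : (i == o0 :> nat) = false) //; lia.
Qed.

Let a1E A : supp (left_rows r) A -> a1 *m A = E o0 o1 *m A.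
Proof.
move=> sA; apply/matrixP => i j; rewrite !mxE; apply: eq_bigr => k _.
have [/a1_left -> //|rk] := ltnP k r.
by rewrite (supp0 sA) ?mulr0 // /left_rows -leqNgt.
Qed.

Let b1E A : supp (right_cols r) A -> A *m b1 = A *m E oq oN.
Proof.
move=> sA; apply/matrixP => i j; rewrite !mxE; apply: eq_bigr => k _.
have [kr|/b1_right -> //] := ltnP k r.
by rewrite (supp0 sA) ?mul0r // /right_cols -ltnNge.
Qed.

Let split_rows w : pat (right_cols r) w -> exists Y0 w0,
  [/\ block Y0, supp (fun i j => r <= i)%N (npart w0), pat (right_cols r) w0 &
      (w = w0 * of_npart Y0)%g].
Proof.
move=> wR; pose Y0 : M := \matrix_(i, j) if (i < r)%N then npart w i j else 0.
have bY0 : block Y0.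
  move=> i j; rewrite mxE; case: ltnP => [ir /wR|]; last by rewrite eqxx.
  by rewrite /rect ir.
have low : supp (fun i j => (r <= i) && (i < j))%N (npart w - Y0).
  move=> i j; rewrite !mxE; case: ltnP => [ir|ri]; first by rewrite subrr eqxx.
  by rewrite subr0 => /npart_supp.
have nlow : npart (of_npart (npart w - Y0)) = npart w - Y0.
  by apply/npart_of_npart/(suppW low) => i j /= /andP[].
have wR0 : pat (right_cols r) (of_npart (npart w - Y0)).
  by rewrite /pat nlow; apply: (suppW low) => i j; rewrite /right_cols; lia.
exists Y0, (of_npart (npart w - Y0)); split=> //.
  by rewrite nlow; apply: (suppW low) => i j /andP[].
apply: npart_inj; rewrite npartM [npart (of_npart Y0)]npart_of_npart; last exact: block_ltn.
by rewrite block_right // addr0 nlow subrK.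
Qed.

Let split_cols w : pat (left_rows r) w -> exists Y0 w0,
  [/\ block Y0, supp (fun i j => j < r)%N (npart w0), pat (left_rows r) w0 &
      (w = of_npart Y0 * w0)%g].
Proof.
move=> wL; pose Y0 : M := \matrix_(i, j) if (r <= j)%N then npart w i j else 0.
have bY0 : block Y0.
  move=> i j; rewrite mxE; case: leqP => [rj /wL|]; last by rewrite eqxx.
  by rewrite /rect rj andbT.
have low : supp (fun i j => (j < r) && (i < j))%N (npart w - Y0).
  move=> i j; rewrite !mxE; case: leqP => [ir|ri]; first by rewrite subrr eqxx.
  by rewrite subr0 => /npart_supp.
have nlow : npart (of_npart (npart w - Y0)) = npart w - Y0.
  by apply/npart_of_npart/(suppW low) => i j /= /andP[].
have wL0 : pat (left_rows r) (of_npart (npart w - Y0)).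
  by rewrite /pat nlow; apply: (suppW low) => i j; rewrite /left_rows; lia.
exists Y0, (of_npart (npart w - Y0)); split=> //.
  by rewrite nlow; apply: (suppW low) => i j /andP[].
apply: npart_inj; rewrite npartM [npart (of_npart Y0)]npart_of_npart; last exact: block_ltn.
by rewrite block_left // addr0 nlow addrC subrK.
Qed.

(** A preimage of [elem j oN 1], stripped of its block, commutes with [x]. Its image
    [E j oN - phi Y0] commutes with [f x], and the term in [phi Y0] reaches row 0 only; the entry
    (i, N) gives the claim. *)
Let a1_corner (i j : 'I_N.+1) : (0 < i)%N -> (r <= j)%N -> (j < N)%N -> a1 i j = 0.
Proof.
move=> i0 rj jN; have ltjN : (j < oN)%N by lia.
have [w Dw] := f_onto (elem j oN 1).
have wR : pat (right_cols r) w.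
  by apply/fR; rewrite Dw /pat npart_elem //; apply: supp_delta; rewrite /right_cols; lia.
have [Y0 [w0 [bY0 sw0 w0R ew]]] := split_rows wR.
have nfw0 : npart (f w0) = E j oN - phi Y0.
  have := congr1 (@npart F N) Dw; rewrite ew fM npartM npart_elem // scale1r -/(phi Y0).
  rewrite (block_right (phi_block bY0)) ?addr0; last exact/fR.
  by move=> <-; rewrite addrK.
have /(congr1 f) : (x * w0 = w0 * x)%g.
  have sx : supp (fun _ j => j < r)%N (npart x).
    by rewrite nx -[E _ _]scale1r; apply: supp_delta; lia.
  apply/comm_npart; rewrite (suppM0 sx sw0) ?(suppM0 w0R xL) //;
  by move=> k q t _ _ _; rewrite /right_cols /left_rows; lia.
rewrite !fM => /comm_npart; rewrite nfw0 -/a1 mulmxBr mulmxBl.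
rewrite [X in _ - X = _]a1E; last exact/blockL/phi_block.
rewrite (block_left (phi_block bY0)) ?subr0; last exact: a1L.
move/(congr1 (fun A : M => A i oN)).
rewrite mxE mulmx_deltar [X in _ + X]mxE !mulmx_deltal eqxx.
have -> : (i == o0) = false by rewrite -val_eqE /=; lia.
rewrite subr0 => ->; case: eqP => // _.
by apply: (supp0 a1L); rewrite /left_rows; lia.
Qed.

Let b1_corner (i j : 'I_N.+1) : (0 < i)%N -> (i < r)%N -> (j < N)%N -> b1 i j = 0.
Proof.
move=> i0 ir jN; have lt0i : (o0 < i)%N by lia.
have [w Dw] := f_onto (elem o0 i 1).
have wL : pat (left_rows r) w.
  by apply/fL; rewrite Dw /pat npart_elem //; apply: supp_delta; rewrite /left_rows; lia.
have [Y0 [w0 [bY0 sw0 w0L ew]]] := split_cols wL.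
have nfw0 : npart (f w0) = E o0 i - phi Y0.
  have := congr1 (@npart F N) Dw; rewrite ew fM npartM npart_elem // scale1r -/(phi Y0).
  rewrite (block_left (phi_block bY0)) ?addr0; last exact/fL.
  by move=> <-; rewrite addrC addKr.
have /(congr1 f) : (y * w0 = w0 * y)%g.
  have sy : supp (fun i _ => r <= i)%N (npart y).
    by rewrite ny -[E _ _]scale1r; apply: supp_delta; lia.
  apply/comm_npart; rewrite (suppM0 sw0 sy) ?(suppM0 yR w0L) //;
  by move=> k q t _ _ _; rewrite /right_cols /left_rows; lia.
rewrite !fM => /comm_npart; rewrite nfw0 -/b1 mulmxBr mulmxBl.
rewrite (block_right (phi_block bY0)) ?subr0; last exact: b1R.
rewrite [X in _ = _ - X]b1E; last exact/blockR/phi_block.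
move/(congr1 (fun A : M => A o0 j)).
rewrite mulmx_deltar mxE mulmx_deltal [X in _ + X]mxE mulmx_deltar eqxx.
have -> : (j == oN) = false by rewrite -val_eqE /=; lia.
rewrite subr0 => <-; case: eqP => // _.
by apply: (supp0 b1R); rewrite /right_cols; lia.
Qed.

(** Away from row 0 and column N, [a1], [b1] and their product contribute nothing to [main_eq]. *)
Let key_entry (i j : 'I_N.+1) : (0 < i)%N -> (i < r)%N -> (r <= j)%N -> (j < N)%N ->
  phi (Xmx l) i j = Xmx m i j.
Proof.
move=> i0 ir rj jN; have := main_entry i j.
rewrite a1_corner // b1_corner // [a1 *m phi _]a1E; last exact/blockL/phi_block.
rewrite !mulmx_deltal [X in 0 + 0 + X]mxE big1 => [|k _]; last first.
  have [kr|rk] := ltnP k r.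
    by rewrite a1_left // mxE -(val_eqE i) /= (_ : (i == o0 :> nat) = false) ?mul0r //; lia.
  by rewrite b1_right // mxE -(val_eqE j) /= (_ : (j == oN :> nat) = false)
       ?andbF ?mulr0 //; lia.
have i0' : (i == o0) = false by rewrite -val_eqE /=; lia.
have jN' : (j == oN) = false by rewrite -val_eqE /=; lia.
by rewrite i0' [E o0 o1 i j]mxE [E oq oN i j]mxE i0' jN' andbF !addr0 !add0r.
Qed.

Let phi_x Y : block Y -> phi (E o0 o1 *m Y) = E o0 o1 *m phi Y.
Proof.
move=> bY; have := phi_left xL bY; rewrite nx => ->; apply: a1E.
exact/blockL/phi_block.
Qed.

Let phi_y Y : block Y -> phi (Y *m E oq oN) = phi Y *m E oq oN.
Proof.
move=> bY; have := phi_right yR bY; rewrite ny => ->; apply: b1E.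
exact/blockR/phi_block.
Qed.

(** Left multiplication by [E a b] after [phi] corresponds to a strictly upper triangular factor
    before it: this tests rows of [phi Y] knowing only that the factor moves rows upwards. *)
Let lift_left (a b : 'I_N.+1) : (a < b)%N -> (b < r)%N -> exists2 g,
  pat (left_rows r) g & forall Y, block Y -> phi (npart g *m Y) = E a b *m phi Y.
Proof.
move=> ltab br; have [g Dg] := f_onto (elem a b 1).
have gL : pat (left_rows r) g.
  by apply/fL; rewrite Dg /pat npart_elem //; apply: supp_delta; rewrite /left_rows; lia.
by exists g => // Y bY; rewrite phi_left // Dg npart_elem // scale1r.
Qed.

Let lift_right (a b : 'I_N.+1) : (a < b)%N -> (r <= a)%N -> exists2 g,
  pat (right_cols r) g & forall Y, block Y -> phi (Y *m npart g) = phi Y *m E a b.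
Proof.
move=> ltab ra; have [g Dg] := f_onto (elem a b 1).
have gR : pat (right_cols r) g.
  by apply/fR; rewrite Dg /pat npart_elem //; apply: supp_delta; rewrite /right_cols; lia.
by exists g => // Y bY; rewrite phi_right // Dg npart_elem // scale1r.
Qed.

Let blockE Y (i j : 'I_N.+1) : block Y -> phi Y i j != 0 -> rect r r i j.
Proof. by move=> bY; apply: (phi_block bY). Qed.

(** [E o1 k] followed by [E o0 o1] would carry a nonzero row [k] to row 0. Before [phi], the lift of
    [E o1 k] already pushes row 1 into row 0, which [E o0 o1] kills. *)
Let row1_phi s (j k c : 'I_N.+1) : (r <= j)%N -> (1 < k)%N -> phi (s *: E o1 j) k c = 0.
Proof.
move=> rj k1; have bY : block (s *: E o1 j) by apply: block_delta; lia.
apply/eqP/negP => /negP nz; have /andP[kr _] := blockE bY nz.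
have lt1k : (o1 < k)%N by lia.
have [g gL Hg] := lift_left lt1k kr.
have bgY := left_block gL bY.
have := phi_x bgY; rewrite Hg //.
have -> : E o0 o1 *m (npart g *m (s *: E o1 j)) = 0.
  apply/matrixP => a b; rewrite mulmx_deltal -scalemxAr [RHS]mxE.
  by rewrite [in X in if _ then X else _]mxE mulmx_deltar npart_low // if_same mulr0 if_same.
rewrite phi0 !mulmxA !mul_delta_mx => /(congr1 (fun A : M => A o0 c)).
rewrite mulmx_deltal eqxx mxE => e; by rewrite -e eqxx in nz.
Qed.

Let row2_phi1 s (j c : 'I_N.+1) : (r <= j)%N -> phi (s *: E o2 j) o1 c = 0.
Proof.
move=> rj; have bY : block (s *: E o2 j) by apply: block_delta; lia.
have := phi_x bY; rewrite -scalemxAr mul_delta_mx_0 ?scaler0 ?phi0; last first.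
  by rewrite -val_eqE /=; lia.
by move/(congr1 (fun A : M => A o0 c)); rewrite mulmx_deltal eqxx mxE.
Qed.

(** Same test with one more upward move: two lifts push row 2 into row 0 before [E o0 o1] acts. *)
Let row2_phi s (j k c : 'I_N.+1) : (r <= j)%N -> (2 < k)%N -> phi (s *: E o2 j) k c = 0.
Proof.
move=> rj k2; have bY : block (s *: E o2 j) by apply: block_delta; lia.
apply/eqP/negP => /negP nz; have /andP[kr _] := blockE bY nz.
have lt2k : (o2 < k)%N by lia.
have [g gL Hg] := lift_left lt2k kr.
have [h hL Hh] : exists2 h, pat (left_rows r) h &
    forall Y, block Y -> phi (npart h *m Y) = E o1 o2 *m phi Y by apply: lift_left; lia.
have bgY := left_block gL bY; have bhY := left_block hL bgY.
have := phi_x bhY; rewrite Hh // Hg //.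
have -> : E o0 o1 *m (npart h *m (npart g *m (s *: E o2 j))) = 0.
  rewrite !mulmxA.
  apply: (@suppM0 _ _ (fun _ j => 2 < j)%N (fun i _ => i == 2)%N).
  - apply: (@suppM _ _ (fun _ j => 1 < j)%N ltn); last by move=> a b c' _ _ _ /=; lia.
      apply: (@suppM _ _ (fun _ j => j == 1)%N ltn); last by move=> a b c' _ _ _ /=; lia.
        by rewrite -[E _ _]scale1r; apply: supp_delta; lia.
      exact: npart_supp.
    exact: npart_supp.
  - by apply: supp_delta; lia.
  by move=> a b c' _ _ _ /=; lia.
rewrite phi0 !mulmxA !mul_delta_mx => /(congr1 (fun A : M => A o0 c)).
rewrite mulmx_deltal eqxx mxE => e; by rewrite -e eqxx in nz.
Qed.

Let colq_phi s (i k c : 'I_N.+1) : (i < r)%N -> (k < oq)%N -> phi (s *: E i oq) c k = 0.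
Proof.
move=> ir kq; have bY : block (s *: E i oq) by apply: block_delta; lia.
apply/eqP/negP => /negP nz; have /andP[_ rk] := blockE bY nz.
have [g gR Hg] := lift_right kq rk.
have bgY := right_block gR bY.
have := phi_y bgY; rewrite Hg //.
have -> : s *: E i oq *m npart g *m E oq oN = 0.
  apply/matrixP => a b; rewrite mulmx_deltar -scalemxAl [RHS]mxE.
  by rewrite [in X in if _ then X else _]mxE mulmx_deltal npart_low // if_same mulr0 if_same.
rewrite phi0 -!mulmxA !mul_delta_mx => /(congr1 (fun A : M => A c oN)).
rewrite mulmx_deltar eqxx mxE => e; by rewrite -e eqxx in nz.
Qed.

Let colp_phiq s (i c : 'I_N.+1) : (i < r)%N -> phi (s *: E i op) c oq = 0.
Proof.
move=> ir; have bY : block (s *: E i op) by apply: block_delta; lia.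
have := phi_y bY; rewrite -scalemxAl mul_delta_mx_0 ?scaler0 ?phi0; last first.
  by rewrite -val_eqE /=; lia.
by move/(congr1 (fun A : M => A c oN)); rewrite mulmx_deltar eqxx mxE.
Qed.

Let colp_phi s (i k c : 'I_N.+1) : (i < r)%N -> (k < op)%N -> phi (s *: E i op) c k = 0.
Proof.
move=> ir kp; have bY : block (s *: E i op) by apply: block_delta; lia.
apply/eqP/negP => /negP nz; have /andP[_ rk] := blockE bY nz.
have [g gR Hg] := lift_right kp rk.
have [h hR Hh] : exists2 h, pat (right_cols r) h &
    forall Y, block Y -> phi (Y *m npart h) = phi Y *m E op oq by apply: lift_right; lia.
have bgY := right_block gR bY; have bhY := right_block hR bgY.
have := phi_y bhY; rewrite Hh // Hg //.
have -> : s *: E i op *m npart g *m npart h *m E oq oN = 0.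
  rewrite -!mulmxA.
  apply: (@suppM0 _ _ (fun _ j => j == op)%N (fun i _ => i < op)%N).
  - by apply: supp_delta; lia.
  - apply: (@suppM _ _ ltn (fun i _ => i < oq)%N); last by move=> a b c' _ _ _ /=; lia.
      exact: npart_supp.
    apply: (@suppM _ _ ltn (fun i _ => i == oq)%N); last by move=> a b c' _ _ _ /=; lia.
      exact: npart_supp.
    by rewrite -[E _ _]scale1r; apply: supp_delta; lia.
  by move=> a b c' _ _ _ /=; lia.
rewrite phi0 -!mulmxA !mul_delta_mx => /(congr1 (fun A : M => A c oN)).
rewrite mulmx_deltar eqxx mxE => e; by rewrite -e eqxx in nz.
Qed.

(** In row 1 of the product, strict triangularity leaves only the rows [k >= 2] of
    [phi (s *: E o2 j)], and [row2_phi] removes those with [k > 2]. *)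
Let phi_scale_left s t (j : 'I_N.+1) : (r <= j)%N ->
  phi ((t * s) *: E o1 j) o1 j = npart (f (elem o1 o2 t)) o1 o2 * phi (s *: E o2 j) o2 j.
Proof.
move=> rj; have bY : block (s *: E o2 j) by apply: block_delta; lia.
have lt12 : (o1 < o2)%N by lia.
have gL : pat (left_rows r) (elem o1 o2 t).
  by rewrite /pat npart_elem //; apply: supp_delta; rewrite /left_rows; lia.
have := phi_left gL bY; rewrite npart_elem // -scalemxAl -scalemxAr mul_delta_mx scalerA => ->.
rewrite mxE (bigD1 o2) //= big1 ?addr0 // => k; rewrite -val_eqE /= => k2.
have [le|lt] := leqP k o1; first by rewrite npart_low ?mul0r.
by rewrite row2_phi ?mulr0 //; lia.
Qed.

Let phi_scale_right s t (i : 'I_N.+1) : (i < r)%N ->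
  phi ((s * t) *: E i oq) i oq = phi (s *: E i op) i op * npart (f (elem op oq t)) op oq.
Proof.
move=> ir; have bY : block (s *: E i op) by apply: block_delta; lia.
have ltpq : (op < oq)%N by lia.
have gR : pat (right_cols r) (elem op oq t).
  by rewrite /pat npart_elem //; apply: supp_delta; rewrite /right_cols; lia.
have := phi_right gR bY.
rewrite npart_elem // -scalemxAl -scalemxAr mul_delta_mx scalerA => ->.
rewrite mxE (bigD1 op) //= big1 ?addr0 // => k; rewrite -val_eqE /= => kp.
have [le|lt] := leqP oq k; first by rewrite npart_low ?mulr0.
by rewrite colp_phi ?mul0r //; lia.
Qed.

Let rho t := npart (f (elem o1 o2 t)) o1 o2.

Let Xmx_entry c : [/\ Xmx c o1 op = c, Xmx c o1 oq = 1, Xmx c o2 op = 1 & Xmx c o2 oq = 1].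
Proof.
have e12 : (o1 == o2) = false by rewrite -val_eqE /=; lia.
have epq : (op == oq) = false by rewrite -val_eqE /=; lia.
by split; rewrite !mxE !eqxx ?[o2 == _]eq_sym ?[oq == op]eq_sym ?e12 ?epq /=
  !(mulr0, mulr1, addr0, add0r).
Qed.

Let phi_entries : [/\ phi (l *: E o1 op) o1 op = m, phi (1 *: E o1 oq) o1 oq = 1,
  phi (1 *: E o2 op) o2 op = 1 & phi (1 *: E o2 oq) o2 oq = 1].
Proof.
have [x1 x2 x3 x4] := Xmx_entry m.
have [lt0_1 lt1r lt0_2 lt2r] : [/\ 0 < o1, o1 < r, 0 < o2 & o2 < r]%N by split; lia.
have [rp pN rq qN] : [/\ r <= op, op < N, r <= oq & oq < N]%N by split; lia.
have [ltpq lt1_1 lt1_2] : [/\ op < oq, 1 < o2 & 0 < o1]%N by split; lia.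
have b1p s : block (s *: E o1 op) := block_delta lt1r rp.
have b1q s : block (s *: E o1 oq) := block_delta lt1r rq.
have b2p s : block (s *: E o2 op) := block_delta lt2r rp.
have b2q s : block (s *: E o2 oq) := block_delta lt2r rq.
have D i j : phi (Xmx l) i j = phi (l *: E o1 op) i j + phi (1 *: E o1 oq) i j
    + (phi (1 *: E o2 op) i j + phi (1 *: E o2 oq) i j).
  rewrite /Xmx (phiD (suppD (b1p l) (b1q 1)) (suppD (b2p 1) (b2q 1))).
  by rewrite (phiD (b1p l) (b1q 1)) (phiD (b2p 1) (b2q 1)) !addE.
have z (a b c d e : F) : b = 0 -> c = 0 -> d = 0 ->
    [/\ e = a + b + (c + d) -> a = e, e = b + a + (c + d) -> a = e,
        e = b + c + (a + d) -> a = e & e = b + c + (d + a) -> a = e].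
  by move=> -> -> ->; rewrite !(addr0, add0r).
split.
- have := key_entry lt0_1 lt1r rp pN; rewrite D x1 => /esym.
  case: (z (phi (l *: E o1 op) o1 op) _ _ _ m (colq_phi 1 o1 lt1r ltpq)
    (row2_phi1 1 op rp) (row2_phi1 1 op rq)).
  by move=> H _ _ _; apply: H.
- have := key_entry lt0_1 lt1r rq qN; rewrite D x2 => /esym.
  case: (z (phi (1 *: E o1 oq) o1 oq) _ _ _ 1 (colp_phiq l o1 lt1r)
    (row2_phi1 1 oq rp) (row2_phi1 1 oq rq)).
  by move=> _ H _ _; apply: H.
- have := key_entry lt0_2 lt2r rp pN; rewrite D x3 => /esym.
  case: (z (phi (1 *: E o2 op) o2 op) _ _ _ 1
    (row1_phi l op rp lt1_1) (row1_phi 1 op rq lt1_1) (colq_phi 1 o2 lt2r ltpq)).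
  by move=> _ _ H _; apply: H.
have := key_entry lt0_2 lt2r rq qN; rewrite D x4 => /esym.
case: (z (phi (1 *: E o2 oq) o2 oq) _ _ _ 1
    (row1_phi l oq rp lt1_1) (row1_phi 1 oq rq lt1_1) (colp_phiq 1 o2 lt2r)).
by move=> _ _ _ H; apply: H.
Qed.

(** The three unit entries of [Xmx] normalize the scaling relations, so [phi] acts by the same [rho]
    on all four entries; moving from row 2 to row 1 then makes [rho] multiplicative. *)
Lemma block_rmorphism : exists sigma : {rmorphism F -> F}, sigma l = m.
Proof.
have [p1 p2 p3 p4] := phi_entries.
have rp : (r <= op)%N by lia.
have rq : (r <= oq)%N by lia.
have p1t t : phi (t *: E o1 op) o1 op = rho t.
  by have := phi_scale_left 1 t rp; rewrite mulr1 p3 mulr1.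
have q1t t : phi (t *: E o1 oq) o1 oq = rho t.
  by have := phi_scale_left 1 t rq; rewrite mulr1 p4 mulr1.
have rho1 : rho 1 = 1 by rewrite -q1t.
have tauE t : npart (f (elem op oq t)) op oq = rho t.
  have ir : (o1 < r)%N by lia.
  by have := phi_scale_right 1 t ir; rewrite mul1r q1t p1t rho1 mul1r.
have q2t t : phi (t *: E o2 oq) o2 oq = rho t.
  have ir : (o2 < r)%N by lia.
  by have := phi_scale_right 1 t ir; rewrite mul1r p3 mul1r tauE.
have rhoM : {morph rho : s t / s * t}.
  by move=> s t; rewrite -q1t phi_scale_left // q2t.
have rhoD : {morph rho : s t / s + t}.
  by move=> s t; rewrite -!p1t scalerDl phiD ?addE //; apply: block_delta; lia.
have rhoB : zmod_morphism rho.
  by move=> s t; apply/(canRL (addrK _)); rewrite -rhoD subrK.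
pose rA := GRing.isZmodMorphism.Build F F rho rhoB.
pose rM := GRing.isMonoidMorphism.Build F F rho (conj rho1 rhoM).
pose sigma : {rmorphism F -> F} := HB.pack rho rA rM.
by exists sigma; rewrite -p1 p1t.
Qed.
End Blocks.

(** * The one-parameter family *)

Section Family.
Variables (F : fieldType) (N : nat).
Hypothesis N5 : (4 < N)%N.
Local Notation G := (UT N.+1 F).
Local Notation o k := (inord k : 'I_N.+1).

Definition family (l : F) : G :=
  cross_ratio_elt (o 0) (o 1) (o 2) (o (N - 2)) (o (N - 1)) (o N) l.

Lemma straight_rmorphism f l m : is_aut f -> straight f -> f (family l) = family m ->
  exists sigma : {rmorphism F -> F}, sigma l = m.
Proof.
move=> fA sf e; have [r [r3 rN fB fR fL]] := straight_blocks fA sf N5.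
by apply: (block_rmorphism r3 rN fA fR fL fB _ _ _ _ _ _ e (erefl _) (erefl _));
  rewrite inordK //; lia.
Qed.

Lemma straight_endo_equiv f l m : is_aut f -> straight f -> f (family l) = family m ->
  endo_equiv l m.
Proof.
move=> fA sf e; split; first exact: straight_rmorphism e.
have [f' [f'A fK f'K]] := is_aut_inv fA.
by apply: (straight_rmorphism f'A (straight_inv f'K sf)); rewrite -e fK.
Qed.

Lemma aut_orbit_eq (g h : G) : aut_orbit g = aut_orbit h -> exists2 f, is_aut f & f g = h.
Proof.
move=> e; have : aut_orbit h h by exists idfun; split=> //; exists id.
by rewrite -e => -[f [bf fgh]]; exists f => //; split=> // x y; apply: gmulfM.
Qed.

(** Each orbit contributes at most two classes: that of [l0], reached by straight automorphisms, and
    one reached only by swaps. *)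
Lemma finite_orbits_classes (t : seq (set G)) : exists s : seq F,
  forall l, aut_orbit (family l) \in t -> exists2 y, y \in s & endo_equiv y l.
Proof.
elim: t => [|O t [s Hs]]; first by exists [::].
have [[l0 Dl0]|noO] := pselect (exists l, aut_orbit (family l) = O); last first.
  exists s => l; rewrite inE => /predU1P[lO|/Hs//].
  by case: noO; exists l.
have [all0|/existsNP[l1 /not_implyP[Dl1 n01]]] :=
    pselect (forall l, aut_orbit (family l) = O -> endo_equiv l0 l).
  exists (l0 :: s) => l; rewrite inE => /predU1P[/all0|/Hs[y ys yl]].
    by exists l0; rewrite ?mem_head.
  by exists y; rewrite // inE ys orbT.
exists [:: l0, l1 & s] => l; rewrite inE => /predU1P[Dl|/Hs[y ys yl]]; last first.
  by exists y; rewrite // !inE ys !orbT.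
have [n0|] := pselect (~ endo_equiv l0 l); last first.
  by move=> /contrapT; exists l0; rewrite ?mem_head.
exists l1; first by rewrite !inE eqxx orbT.
have sw k : aut_orbit (family k) = O -> ~ endo_equiv l0 k ->
    exists2 f, is_aut f /\ swapped f & f (family l0) = family k.
  move=> Dk nk; have [f fA e] := aut_orbit_eq (etrans Dl0 (esym Dk)).
  exists f => //; split=> //; have [sf|//] := straight_or_swapped N5 fA.
  by case: nk; apply: straight_endo_equiv e.
have [f1 [f1A s1] e1] := sw _ Dl1 n01; have [f2 [f2A s2] e2] := sw _ Dl n0.
have [f1' [f1'A f1K f1'K]] := is_aut_inv f1A.
(* Both [l1] and [l] are reached from [l0] by swaps, so the composite through [l0] is straight. *)
apply: (straight_endo_equiv (is_aut_comp f2A f1'A)).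
  exact: swapped_comp N5 f2A f1'A f1'K s2 s1.
by rewrite /= -e1 f1K.
Qed.
End Family.

Theorem theorem1p2 (F : fieldType) (infF : infinite_set [set: F]%classic)
  (n : nat) (hn : (6 <= n)%N) : infinite_set (aut_orbits (UT n F)).
Proof.
case: n hn => // N; rewrite ltnS => N5 /finite_seqP[t Dt].
have [s Hs] := finite_orbits_classes N5 t.
have [l Hl] := endo_classes_infinite infF s.
have [|y ys yl] := Hs l; last exact: Hl ys yl.
suff : [set` t]%classic (aut_orbit (family N l)) by [].
by rewrite -Dt; exists (family N l).
Qed.
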